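(* Let $G$ be a Polish group. Then $G$ is amenable if and only if every continuous action of $G$ on the Hilbert cube $I^{\aleph_0}=[0,1]^{\aleph_0}$ admits an invariant Borel probability measure.
   Context: A Polish group is a topological group whose topology is separable and completely metrizable. A continuous action of a topological group $G$ on a topological space $X$ is a group action for which the map $G\times X\to X$, $(g,x)\mapsto gx$, is jointly continuous. A topological group $G$ is called amenable if every continuous action of $G$ on a (nonempty) compact Hausdorff space $X$ admits an invariant (regular) Borel probability measure, i.e. a Borel probability measure $\mu$ on $X$ with $\mu(g^{-1}A)=\mu(A)$ for all $g\in G$ and all Borel $A\subseteq X$. *)

(* Defs.v *)
From HB Require Import structures.
From mathcomp Require Import all_boot all_order all_algebra.
From mathcomp Require Import all_classical all_reals all_analysis.

Set Implicit Arguments.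
Unset Strict Implicit.
Unset Printing Implicit Defensive.

Import Order.TTheory GRing.Theory Num.Theory.
Import numFieldNormedType.Exports.

Local Open Scope classical_set_scope.
Local Open Scope ring_scope.

HB.mixin Record Topological_isTopologicalGroup G
    & Topological G & Group G := {
  mulg_continuous : continuous (fun p : G * G => (p.1 * p.2)%g) ;
  invg_continuous : continuous (fun x : G => x^-1%g) ;
}.

#[short(type="topologicalGroupType")]
HB.structure Definition TopologicalGroup :=
  {G of Topological G & Group G & Topological_isTopologicalGroup G}.

Definition separable_space (T : topologicalType) : Prop :=
  exists2 D : set T, countable D & dense D.

Section CompletelyMetrizable.
Variables (R : realType) (T : topologicalType).
Implicit Type d : T -> T -> R.

Definition is_metric d : Prop :=
  [/\ forall x y, 0 <= d x y,
      forall x y, d x y = 0 <-> x = y,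
      forall x y, d x y = d y x &
      forall x y z, d x z <= d x y + d y z].

Definition induces_topology d : Prop :=
  forall (x : T) (A : set T),
    nbhs x A <-> exists2 e : R, 0 < e & [set y | d x y < e] `<=` A.

Definition complete_metric d : Prop :=
  forall u : nat -> T,
    (forall e : R, 0 < e ->
       exists N : nat, forall m n, (N <= m)%N -> (N <= n)%N ->
         d (u m) (u n) < e) ->
    exists l : T, u @ \oo --> l.

Definition completely_metrizable : Prop :=
  exists d, [/\ is_metric d, induces_topology d & complete_metric d].

End CompletelyMetrizable.

Definition polish (R : realType) (T : topologicalType) : Prop :=
  separable_space T /\ completely_metrizable R T.

Definition continuous_action (G : topologicalGroupType) (X : topologicalType)
    (act : G -> X -> X) : Prop :=
  [/\ forall x, act 1%g x = x,
      forall g h x, act (g * h)%g x = act g (act h x) &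
      continuous (fun p : G * X => act p.1 p.2)].

(* [X] equipped with its Borel sigma-algebra; the library only puts a
   measurable structure on pointed types, i.e. nonempty ones. *)
Definition borel (X : ptopologicalType) := g_sigma_algebraType (@open X).

HB.instance Definition _ (X : ptopologicalType) := Measurable.on (borel X).

Section BorelProbability.
Variables (R : realType) (X : ptopologicalType).
Implicit Type mu : probability (borel X) R.

Definition invariant_measure (G : topologicalGroupType) (act : G -> X -> X) mu : Prop :=
  forall (g : G) (A : set (borel X)), measurable A ->
    mu (act g^-1%g @` A) = mu A.

Definition regular_measure mu : Prop :=
  forall A : set (borel X), measurable A ->
    mu A = ereal_inf [set mu U | U in [set U : set X | open U /\ A `<=` U]] /\
    mu A = ereal_sup [set mu K | K in [set K : set X | compact K /\ K `<=` A]].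

End BorelProbability.

(* Nonemptiness of the compact space is built into [ptopologicalType]. *)
Definition amenable (R : realType) (G : topologicalGroupType) : Prop :=
  forall X : ptopologicalType, compact [set: X] -> hausdorff_space X ->
  forall act : G -> X -> X, continuous_action act ->
    exists mu : probability (borel X) R, regular_measure mu /\ invariant_measure act mu.

Definition hilbert_cube (R : realType) : Type :=
  prod_topology (fun _ : nat => set_type `[0 : R, 1]%classic).

HB.instance Definition _ (R : realType) := Topological.on (hilbert_cube R).

Lemma zero_in_unit_itv (R : realType) : (0 : R) \in `[0 : R, 1]%classic.
Proof. by rewrite inE /= in_itv /= lexx ler01. Qed.

HB.instance Definition _ (R : realType) :=
  isPointed.Build (hilbert_cube R) (fun=> SigSub (zero_in_unit_itv R)).

(* Main.v *)
Require Import Defs.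
From HB Require Import structures.
From mathcomp Require Import all_boot all_order all_algebra finmap.
From mathcomp Require Import all_classical all_reals all_analysis.
From mathcomp Require Import measurable_realfun.
From mathcomp Require Import ring lra.
From Stdlib Require Cantor.

(** Let G act on a compact space X.  Given finitely many continuous functions
    phi_i on X, let K be the compact convex set of all functions
    (i, h) |-> L (phi_i o h) on nat * G, where L ranges over the states of C(X).
    It is metrizable because these functions are equicontinuous in h and G is
    separable, and G acts on it continuously by right translation of h.
    As K * Q * Q is homeomorphic to the Hilbert cube Q, G acts on Q with an
    equivariant map Q -> K.  The barycentre in K of an invariant measure on Q is
    constant in h, i.e. it comes from a state invariant on the phi_i; compactness
    of the state space gives an invariant state, and the Riesz construction an
    invariant regular measure.

    That K * Q * Q is Q replaces Keller's theorem.  Coordinates y_n on K * Q are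
    chosen so that, given y_0, ..., y_(n-1), the admissible values of y_n form an
    interval whose end points depend continuously on the point.  The width of
    such an interval may vanish, but the family [0, w] * Q is homeomorphic to Q
    continuously in w down to w = 0: insert the new coordinate in the sequence q
    at a position of order 1/w.  One factor Q thus absorbs all the intervals. *)

Set Implicit Arguments.
Unset Strict Implicit.
Unset Printing Implicit Defensive.

Import Order.TTheory GRing.Theory Num.Theory.
Import numFieldNormedType.Exports.

Local Open Scope classical_set_scope.
Local Open Scope ring_scope.

(** The cube is metrizable, whereas the state space of C(X) is not when [X] is not metrizable. An
    action on the cube can therefore only see a countable amount of data; this forces the passage
    through finitely many functions and a compactness argument at the end.

    The obstacle in straightening is the continuity of the end points. For a general compact convex
    set, the maximum of one coordinate on a slice where earlier coordinates are prescribed is only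
    upper semicontinuous: a small change of the prescribed values can shrink the slice abruptly. The
    first factor Q cures this. Its coordinates enter multiplied by a positive, strictly concave
    function of the point of K, so a proper mixture of two points with different K-parts has slack
    in all these coordinates at once, and the slack absorbs small changes of the prescribed values.
    The second factor Q only serves to swallow the intervals. *)

Section MaxMin.
Context {R : realType} {T : Type} {F : set_system T} {FF : Filter F}.
Variables (f g : T -> R) (a b : R).
Hypotheses (cf : f @ F --> a) (cg : g @ F --> b).

Lemma cvg_maxr : (fun x => Num.max (f x) (g x)) @ F --> Num.max a b.
Proof.
have -> : (fun x => Num.max (f x) (g x)) = (fun x => 2^-1 * (f x + g x + `|f x - g x|)).
  by apply/funext => x; rewrite maxr_absE mulrC.
have -> : Num.max a b = 2^-1 * (a + b + `|a - b|) by rewrite maxr_absE mulrC.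
by apply: cvgM; [exact: cvg_cst|apply: cvgD; [exact: cvgD|apply: cvg_norm; exact: cvgB]].
Qed.

Lemma cvg_minr : (fun x => Num.min (f x) (g x)) @ F --> Num.min a b.
Proof.
have -> : (fun x => Num.min (f x) (g x)) = (fun x => 2^-1 * (f x + g x - `|f x - g x|)).
  by apply/funext => x; rewrite minr_absE mulrC.
have -> : Num.min a b = 2^-1 * (a + b - `|a - b|) by rewrite minr_absE mulrC.
by apply: cvgM; [exact: cvg_cst|apply: cvgB; [exact: cvgD|apply: cvg_norm; exact: cvgB]].
Qed.

End MaxMin.

(** * Rotations of the square *)

Section SquareRotation.
Variable R : realType.
Implicit Types t c q o d : R.

(* [rota] and [rotb] are the components of a segment of invertible linear maps
   from a quarter turn ([t = 0]) to the identity ([t = 1]); rescaling them to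
   preserve the sup norm gives homeomorphisms of the square [-1, 1]^2. *)
Definition rota t c q := (1 - t) * q + t * c.
Definition rotb t c q := t * q - (1 - t) * c.
Definition supn c q := Num.max `|c| `|q|.
Definition rotation_scale t c q := supn c q / supn (rota t c q) (rotb t c q).
Definition rotation_out t c q := rotation_scale t c q * rota t c q.
Definition rotation_carry t c q := rotation_scale t c q * rotb t c q.

Lemma supn_ge0 c q : 0 <= supn c q.
Proof. by rewrite /supn le_max normr_ge0. Qed.

Lemma supn_eq0 c q : (supn c q == 0) = (c == 0) && (q == 0).
Proof.
rewrite eq_le supn_ge0 andbT /supn ge_max !normr_le0.
by [].
Qed.

Lemma supnZ k c q : 0 <= k -> supn (k * c) (k * q) = k * supn c q.
Proof. by move=> k0; rewrite /supn !normrM (ger0_norm k0) maxr_pMr. Qed.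

Lemma supn_le c q e : (supn c q <= e) = (`|c| <= e) && (`|q| <= e).
Proof. by rewrite /supn ge_max. Qed.

Lemma rotation_det_gt0 t : 0 < t ^+ 2 + (1 - t) ^+ 2.
Proof. nra. Qed.

Lemma rotation_eq0 t c q : (supn (rota t c q) (rotb t c q) == 0) = (supn c q == 0).
Proof.
rewrite !supn_eq0; apply/andP/andP => -[/eqP a0 /eqP b0]; last first.
  by rewrite a0 b0 /rota /rotb !mulr0 subrr addr0.
have D := rotation_det_gt0 t.
have c0 : (t ^+ 2 + (1 - t) ^+ 2) * c = 0.
  transitivity (t * rota t c q - (1 - t) * rotb t c q); last by rewrite a0 b0 !mulr0 subrr.
  by rewrite /rota /rotb; ring.
have q0 : (t ^+ 2 + (1 - t) ^+ 2) * q = 0.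
  transitivity ((1 - t) * rota t c q + t * rotb t c q); last by rewrite a0 b0 !mulr0 addr0.
  by rewrite /rota /rotb; ring.
move/eqP: c0; move/eqP: q0; rewrite !mulf_eq0 gt_eqF//=.
Qed.

Lemma rotation_scale_ge0 t c q : 0 <= rotation_scale t c q.
Proof. by rewrite divr_ge0 ?supn_ge0. Qed.

Lemma supn_rotation t c q : supn (rotation_out t c q) (rotation_carry t c q) = supn c q.
Proof.
rewrite supnZ ?rotation_scale_ge0// /rotation_scale.
have [/eqP v0|v0] := boolP (supn c q == 0); first by rewrite v0 !mul0r.
by rewrite divfK// rotation_eq0.
Qed.

Lemma rotation_bound t c q : `|c| <= 1 -> `|q| <= 1 ->
  `|rotation_out t c q| <= 1 /\ `|rotation_carry t c q| <= 1.
Proof.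
move=> c1 q1; have : supn (rotation_out t c q) (rotation_carry t c q) <= 1.
  by rewrite supn_rotation supn_le c1.
by rewrite supn_le => /andP.
Qed.

Lemma rotation_scale1 t c q : supn (rota t c q) (rotb t c q) = supn c q ->
  rotation_out t c q = rota t c q /\ rotation_carry t c q = rotb t c q.
Proof.
move=> e; rewrite /rotation_out /rotation_carry /rotation_scale e.
have [v0|v0] := boolP (supn c q == 0); last by rewrite divff// !mul1r.
have /andP[/eqP -> /eqP ->] : (rota t c q == 0) && (rotb t c q == 0).
  by rewrite -supn_eq0 rotation_eq0.
by rewrite !mulr0.
Qed.

(** The sign is the price of connectedness: the plain swap of [c] and [q] has determinant -1 and
    cannot be joined to the identity through invertible maps, whereas the quarter turn can. *)
Lemma rotation0 c q : rotation_out 0 c q = q /\ rotation_carry 0 c q = - c.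
Proof.
have [|-> ->] := @rotation_scale1 0 c q.
  by rewrite /rota /rotb /supn subr0 !mul1r !mul0r addr0 sub0r normrN maxC.
by rewrite /rota /rotb subr0 !mul1r !mul0r addr0 sub0r.
Qed.

Lemma rotation1 c q : rotation_out 1 c q = c /\ rotation_carry 1 c q = q.
Proof.
have [|-> ->] := @rotation_scale1 1 c q.
  by rewrite /rota /rotb /supn subrr !mul1r !mul0r add0r subr0.
by rewrite /rota /rotb subrr !mul1r !mul0r add0r subr0.
Qed.

(** The transposed matrix inverts the linear map up to the factor [t ^+ 2 + (1 - t) ^+ 2], so equal
    outputs make [(c, q)] and [(c', q')] proportional with positive factors [k], [k']; as the sup
    norm is preserved, [k = k']. *)
Lemma rotation_inj t c q c' q' : rotation_out t c q = rotation_out t c' q' ->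
  rotation_carry t c q = rotation_carry t c' q' -> c = c' /\ q = q'.
Proof.
move=> eo ec; have es : supn c q = supn c' q' by rewrite -(supn_rotation t) eo ec supn_rotation.
have [v0|v0] := boolP (supn c q == 0).
  move: (v0) (v0); rewrite {2}es !supn_eq0 => /andP[/eqP -> /eqP ->].
  by move=> /andP[/eqP -> /eqP ->].
have s0 : rotation_scale t c q != 0 by rewrite mulf_neq0// invr_neq0// rotation_eq0.
have v0' : supn c' q' != 0 by rewrite -es.
have s0' : rotation_scale t c' q' != 0 by rewrite mulf_neq0// invr_neq0// rotation_eq0.
have sp : 0 < rotation_scale t c q by rewrite lt_neqAle eq_sym s0 rotation_scale_ge0.
have sp' : 0 < rotation_scale t c' q' by rewrite lt_neqAle eq_sym s0' rotation_scale_ge0.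
set k := rotation_scale t c q in s0 sp.
set k' := rotation_scale t c' q' in s0' sp'.
have {}eo : k * rota t c q = k' * rota t c' q' := eo.
have {}ec : k * rotb t c q = k' * rotb t c' q' := ec.
have D := rotation_det_gt0 t.
have D0 : t ^+ 2 + (1 - t) ^+ 2 != 0 by rewrite gt_eqF.
have ekc : k * c = k' * c'.
  apply: (mulfI D0).
  transitivity (t * (k * rota t c q) - (1 - t) * (k * rotb t c q)).
    by rewrite /rota /rotb; ring.
  rewrite eo ec.
  by rewrite /rota /rotb; ring.
have ekq : k * q = k' * q'.
  apply: (mulfI D0).
  transitivity ((1 - t) * (k * rota t c q) + t * (k * rotb t c q)).
    by rewrite /rota /rotb; ring.
  rewrite eo ec.
  by rewrite /rota /rotb; ring.
have kk : k = k'.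
  have := supnZ c q (ltW sp); rewrite ekc ekq supnZ ?(ltW sp')// -es => /(mulIf v0).
  by [].
by move: ekc ekq; rewrite -kk => /(mulfI s0) -> /(mulfI s0) ->.
Qed.

Lemma rotation_surj t o d : `|o| <= 1 -> `|d| <= 1 -> exists c q,
  [/\ `|c| <= 1, `|q| <= 1, rotation_out t c q = o & rotation_carry t c q = d].
Proof.
move=> o1 d1.
have [|v0] := boolP (supn o d == 0).
  rewrite supn_eq0 => /andP[/eqP -> /eqP ->]; exists 0, 0.
  by rewrite normr0 ler01 /rotation_out /rotation_carry /rota /rotb !(mulr0, addr0, subr0).
(* The transposed matrix applied to [(o, d)] gives the right direction; [k] below corrects the
   length. *)
pose c := t * o - (1 - t) * d; pose q := (1 - t) * o + t * d.
have D := rotation_det_gt0 t; set D' := (_ + _) in D.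
have ea : rota t c q = D' * o by rewrite /rota /c /q /D'; ring.
have eb : rotb t c q = D' * d by rewrite /rotb /c /q /D'; ring.
have n0 : supn c q != 0 by rewrite -(rotation_eq0 t) ea eb supnZ ?ltW// mulf_neq0// gt_eqF.
have np : 0 < supn c q by rewrite lt_neqAle eq_sym n0 supn_ge0.
have vp : 0 < supn o d by rewrite lt_neqAle eq_sym v0 supn_ge0.
pose k := supn o d / supn c q.
have kp : 0 < k by rewrite divr_gt0.
have e1 : supn (k * c) (k * q) = supn o d by rewrite supnZ ?ltW// /k divfK.
have ra : rota t (k * c) (k * q) = (k * D') * o by rewrite -mulrA -ea /rota; ring.
have rb : rotb t (k * c) (k * q) = (k * D') * d by rewrite -mulrA -eb /rotb; ring.
have kD : 0 < k * D' by rewrite mulr_gt0.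
have sc : rotation_scale t (k * c) (k * q) * (k * D') = 1.
  rewrite /rotation_scale e1 ra rb supnZ ?(ltW kD)//.
  by rewrite mulrAC [X in X / _]mulrC divff// mulf_neq0// gt_eqF.
have : supn (k * c) (k * q) <= 1 by rewrite e1 supn_le o1.
rewrite supn_le => /andP[? ?].
exists (k * c), (k * q); split => //.
  by rewrite /rotation_out ra mulrA sc mul1r.
by rewrite /rotation_carry rb mulrA sc mul1r.
Qed.

Section continuity.
Context {T : Type} {F : set_system T} {FF : Filter F}.
Variables (t c q : T -> R) (t0 c0 q0 : R).
Hypotheses (ct : t @ F --> t0) (cc : c @ F --> c0) (cq : q @ F --> q0).

Lemma cvg_supn (f g : T -> R) (a b : R) : f @ F --> a -> g @ F --> b ->
  (fun x => supn (f x) (g x)) @ F --> supn a b.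
Proof.
move=> cf cg; apply: cvg_maxr; exact: cvg_norm.
Qed.

Lemma cvg_rota : (fun x => rota (t x) (c x) (q x)) @ F --> rota t0 c0 q0.
Proof.
apply: cvgD; apply: cvgM => //; apply: cvgB => //; exact: cvg_cst.
Qed.

Lemma cvg_rotb : (fun x => rotb (t x) (c x) (q x)) @ F --> rotb t0 c0 q0.
Proof.
apply: cvgB; apply: cvgM => //; apply: cvgB => //; exact: cvg_cst.
Qed.

Lemma rotation_le_supn t' c' q' : `|rotation_out t' c' q'| <= supn c' q' /\
  `|rotation_carry t' c' q'| <= supn c' q'.
Proof. by have := lexx (supn c' q'); rewrite -{1}(supn_rotation t') supn_le => /andP. Qed.

Lemma cvg_rotation : (fun x => rotation_out (t x) (c x) (q x)) @ F --> rotation_out t0 c0 q0 /\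
  (fun x => rotation_carry (t x) (c x) (q x)) @ F --> rotation_carry t0 c0 q0.
Proof.
have cs : (fun x => supn (c x) (q x)) @ F --> supn c0 q0 by exact: cvg_supn.
(* At the origin [rotation_scale] need not converge, but both outputs are squeezed by [supn], which
   tends to 0. *)
have [v0|v0] := boolP (supn c0 q0 == 0).
  have : rotation_out t0 c0 q0 = 0 /\ rotation_carry t0 c0 q0 = 0.
    have [] := rotation_le_supn t0 c0 q0; rewrite (eqP v0) !normr_le0.
    by move=> /eqP -> /eqP ->.
  move=> [-> ->]; rewrite (eqP v0) in cs.
  have cs' : (fun x => - supn (c x) (q x)) @ F --> (0 : R) by rewrite -oppr0; exact: cvgN.
  split; apply: (squeeze_cvgr _ cs' cs); apply: nearW => x; rewrite -ler_norml.
    by have [] := rotation_le_supn (t x) (c x) (q x).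
  by have [] := rotation_le_supn (t x) (c x) (q x).
have ck : (fun x => rotation_scale (t x) (c x) (q x)) @ F --> rotation_scale t0 c0 q0.
  apply: cvgM => //; apply: cvgV; first by rewrite rotation_eq0.
  exact: (cvg_supn cvg_rota cvg_rotb).
by split; apply: cvgM => //; [exact: cvg_rota|exact: cvg_rotb].
Qed.

End continuity.

End SquareRotation.

(** * Absorbing an interval into a sequence *)

Section Absorption.
Variable R : realType.
Implicit Types (t q : nat -> R) (c w s : R).

(** Cell [k] turns the incoming carry and [q k] into an output and an outgoing carry. Each cell is a
    bijection of the square, so a finite prefix can be inverted backwards from its outputs and its
    last carry. *)
Fixpoint carry t q c k : R :=
  if k is k'.+1 then rotation_carry (t k') (carry t q c k') (q k') else c.

Definition chain t q c k : R := rotation_out (t k) (carry t q c k) (q k).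

Lemma carry_bound t q c k : (forall j, `|q j| <= 1) -> `|c| <= 1 ->
  `|carry t q c k| <= 1.
Proof. by move=> q1 c1; elim: k => //= k IH; have [] := rotation_bound (t k) IH (q1 k). Qed.

Lemma chain_bound t q c k : (forall j, `|q j| <= 1) -> `|c| <= 1 ->
  `|chain t q c k| <= 1.
Proof.
by move=> q1 c1; have [] := rotation_bound (t k) (carry_bound t k q1 c1) (q1 k).
Qed.

Lemma carry_ext t q q' c k : (forall j, (j < k)%N -> q j = q' j) ->
  carry t q c k = carry t q' c k.
Proof.
elim: k => //= k IH e; rewrite IH ?e// => j jk; apply: e; exact: ltnW.
Qed.

Lemma chain_prefix_inj t q q' c c' k :
  (forall j, (j < k)%N -> chain t q c j = chain t q' c' j) ->
  carry t q c k = carry t q' c' k ->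
  c = c' /\ (forall j, (j < k)%N -> q j = q' j).
Proof.
elim: k => [//|k IH e ec].
have [e1 e2] := rotation_inj (e k (ltnSn k)) ec.
have [|-> qq] := IH _ e1; first by move=> j jk; apply: e; exact: ltnW.
by split=> // j; rewrite ltnS leq_eqVlt => /predU1P[->//|]; exact: qq.
Qed.

Lemma chain_prefix_surj t o d k : (forall j, `|o j| <= 1) -> `|d| <= 1 ->
  exists c q, [/\ `|c| <= 1, forall j, `|q j| <= 1, carry t q c k = d &
    forall j, (j < k)%N -> chain t q c j = o j].
Proof.
move=> o1; elim: k d => [|k IH] d d1.
  by exists d, (fun=> 0); split=> // j; rewrite normr0.
have [ck [qk [ck1 qk1 eo ed]]] := rotation_surj (t k) (o1 k) d1.
have [c [q [c1 q1 ec ej]]] := IH _ ck1.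
exists c, (fun j => if j == k then qk else q j).
have ext j : (j <= k)%N ->
    carry t (fun i => if i == k then qk else q i) c j = carry t q c j.
  by move=> jk; apply: carry_ext => i ij; rewrite ltn_eqF// (leq_trans ij).
split=> //.
- by move=> j; case: ifP.
- by rewrite /= ext// eqxx ec ed.
- move=> j; rewrite ltnS leq_eqVlt => /predU1P[->|jk].
    by rewrite /chain ext// eqxx ec eo.
  by rewrite /chain (ext _ (ltnW jk)) (ltn_eqF jk); exact: ej.
Qed.

(* The carried value goes past [q_k] while [k * w <= 1] and pushes it one step
   further as soon as [2 <= k * w].  [start w s] rescales [s] in [0, w] to
   [-1, 1]; at [w = 0] it has the junk value [-1], which is carried for ever and
   never output. *)
Definition pace w k : R := Num.min 1 (Num.max 0 (k%:R * w - 1)).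
Definition start w s : R := 2 * s / w - 1.
Definition absorb w s q k : R := chain (pace w) q (start w s) k.

Lemma pace0 w k : k%:R * w <= 1 -> pace w k = 0.
Proof.
by move=> h; rewrite /pace max_l ?subr_le0// min_r.
Qed.

Lemma pace1 w k : 2 <= k%:R * w -> pace w k = 1.
Proof. by move=> h; rewrite /pace min_l// le_max lerBrDr h orbT. Qed.

Lemma chain_pace1 w q c k : 2 <= k%:R * w -> chain (pace w) q c k = carry (pace w) q c k.
Proof. by move=> h; rewrite /chain pace1// (rotation1 _ _).1. Qed.

Lemma carry_pace1 w q c k : 2 <= k%:R * w -> carry (pace w) q c k.+1 = q k.
Proof. by move=> h; rewrite /= pace1// (rotation1 _ _).2. Qed.

Lemma chain_pace0 w q c k : k%:R * w <= 1 -> chain (pace w) q c k = q k.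
Proof. by move=> h; rewrite /chain pace0// (rotation0 _ _).1. Qed.

Lemma pace_large w : 0 < w -> exists N, forall k, (N <= k)%N -> 2 <= k%:R * w.
Proof.
move=> w0; exists (Num.truncn (2 / w)).+1 => k Nk.
rewrite -ler_pdivrMr//; apply: le_trans (ltW (truncnS_gt (2 / w))) _.
by rewrite ler_nat.
Qed.

Lemma start_bound w s : 0 <= s <= w -> `|start w s| <= 1.
Proof.
move=> /andP[s0 sw]; have w0 : 0 <= w by exact: le_trans sw.
rewrite ler_norml /start.
have : 0 <= s / w by rewrite divr_ge0.
have : s / w <= 1.
  have [->|wn] := eqVneq w 0; first by rewrite invr0 mulr0.
  by rewrite ler_pdivrMr ?mul1r// lt_neqAle eq_sym wn.
by rewrite -mulrA => h1 h2; apply/andP; split; lra.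
Qed.

Lemma absorb_bound w s q k : 0 <= s <= w -> (forall j, `|q j| <= 1) ->
  `|absorb w s q k| <= 1.
Proof. by move=> sw q1; apply: chain_bound => //; exact: start_bound. Qed.

(** For [w > 0], cells with [2 <= k * w] emit the carry they receive: equal outputs give equal
    carries at every late position, and the prefix before it is inverted. For [w <= 0] both [s] and
    [s'] are 0 and the output is the sequence itself. *)
Lemma absorb_inj w s s' q q' : 0 <= s <= w -> 0 <= s' <= w ->
  (forall k, absorb w s q k = absorb w s' q' k) -> s = s' /\ (forall k, q k = q' k).
Proof.
move=> /andP[s0 sw] /andP[s0' sw'] e.
have [w0|w0] := ltP 0 w; last first.
  have -> : s = 0 by apply/eqP; rewrite eq_le s0 (le_trans sw).
  have -> : s' = 0 by apply/eqP; rewrite eq_le s0' (le_trans sw').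
  split=> // k; have := e k; rewrite /absorb !chain_pace0//;
    by rewrite (le_trans _ (@ler01 R))// mulr_ge0_le0.
have [N hN] := pace_large w0.
have ec k : (N <= k)%N ->
    carry (pace w) q (start w s) k = carry (pace w) q' (start w s') k.
  by move=> Nk; rewrite -!chain_pace1 ?hN//; exact: e.
have h k : (N <= k)%N -> start w s = start w s' /\
    forall j, (j < k)%N -> q j = q' j.
  by move=> Nk; apply: chain_prefix_inj => [j _|]; [exact: e|exact: ec].
split.
  have [+ _] := h N (leqnn _); rewrite /start => /addIr.
  have wi : w^-1 != 0 by rewrite invr_eq0 gt_eqF.
  by move=> /(mulIf wi)/mulfI; apply; rewrite pnatr_eq0.
move=> k; have [_] := h (maxn N k.+1) (leq_maxl _ _); apply.
exact: leq_maxr.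
Qed.

Lemma absorb_surj w o : 0 <= w -> (forall k, `|o k| <= 1) ->
  exists s q, [/\ 0 <= s <= w, forall k, `|q k| <= 1 & forall k, absorb w s q k = o k].
Proof.
rewrite le_eqVlt => /predU1P[<-|w0] o1.
  exists 0, o; rewrite lexx; split=> // k.
  by rewrite /absorb chain_pace0// mulr0 ler01.
have [N hN] := pace_large w0.
(* Cell [N] already emits its incoming carry, so that carry must be [o N]. From there on the output
   is the input delayed by one, whence [o k.+1] in [q']. *)
have [c [q [c1 q1 ec eo]]] := chain_prefix_surj (pace w) N o1 (o1 N).
pose q' k := if (k < N)%N then q k else o k.+1.
have ext j : (j <= N)%N -> carry (pace w) q' c j = carry (pace w) q c j.
  by move=> jN; apply: carry_ext => i ij; rewrite /q' (leq_trans ij).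
exists (w * (c + 1) / 2), q'.
have st : start w (w * (c + 1) / 2) = c.
  by rewrite /start; field; rewrite gt_eqF.
split.
- move: c1; rewrite ler_norml => /andP[c1 c2].
  by apply/andP; split; nra.
- by move=> k; rewrite /q'; case: ifP.
- move=> k; rewrite /absorb st.
  have [kN|Nk] := ltnP k N.
    by rewrite -eo// /chain ext ?(ltnW kN)// /q' kN.
  rewrite chain_pace1 ?hN//.
  case: k Nk => [|k] Nk.
    by move: Nk ec; rewrite leqn0 => /eqP ->.
  move: Nk; rewrite leq_eqVlt => /predU1P[Nk|Nk].
    by rewrite -Nk ext// ec.
  by rewrite carry_pace1 ?hN// /q' ltnNge -ltnS Nk.
Qed.

Section continuity.
Context {T : Type} {F : set_system T} {FF : Filter F}.
Variables (W S : T -> R) (Q : T -> nat -> R) (w0 s0 : R) (q0 : nat -> R).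
Hypotheses (cW : W @ F --> w0) (cS : S @ F --> s0).
Hypothesis cQ : forall k, Q ^~ k @ F --> q0 k.

Lemma cvg_pace k : (fun x => pace (W x) k) @ F --> pace w0 k.
Proof.
have h : (fun x => k%:R * W x - 1) @ F --> k%:R * w0 - 1.
  by apply: cvgB; [apply: cvgM => //; exact: cvg_cst|exact: cvg_cst].
apply: (@cvg_minr _ _ _ _ (cst 1)); first exact: cvg_cst.
by apply: (@cvg_maxr _ _ _ _ (cst 0)) => //; exact: cvg_cst.
Qed.

(** At width 0 the start value [2 * s / w - 1] need not converge. This does no harm: for fixed [k],
    nearby widths satisfy [k * w <= 1], and then output [k] is just [q k]. *)
Lemma cvg_absorb k : 0 <= w0 ->
  (fun x => absorb (W x) (S x) (Q x) k) @ F --> absorb w0 s0 q0 k.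
Proof.
rewrite le_eqVlt => /predU1P[w00|wp].
  rewrite /absorb -w00 chain_pace0 ?mulr0 ?ler01//.
  have nW : \forall x \near F, k%:R * W x <= 1.
    have h : (fun x => k%:R * W x) @ F --> k%:R * w0 by apply: cvgM => //; exact: cvg_cst.
    rewrite -w00 mulr0 in h.
    have h1 : \forall x \near F, k%:R * W x < 1 by apply: (cvgr_lt 0) => //; exact: ltr01.
    by apply: filterS h1 => x /ltW.
  apply: cvg_trans; last exact: cQ.
  by apply: near_eq_cvg; apply: filterS nW => x hx; rewrite chain_pace0.
have cst0 : (fun x => start (W x) (S x)) @ F --> start w0 s0.
  apply: cvgB; last exact: cvg_cst.
  apply: cvgM; first by apply: cvgM => //; exact: cvg_cst.
  by apply: cvgV => //; rewrite gt_eqF.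
have cc j : (fun x => carry (pace (W x)) (Q x) (start (W x) (S x)) j) @ F -->
    carry (pace w0) q0 (start w0 s0) j.
  elim: j => [//|j IH /=].
  by have [_] := cvg_rotation (@cvg_pace j) IH (@cQ j).
by have [] := cvg_rotation (@cvg_pace k) (@cc k) (@cQ k).
Qed.

End continuity.
End Absorption.

(** * The Hilbert cube *)

Section Topology.

Lemma cvg_pointwise (I : Type) (T : I -> topologicalType)
    (S : Type) (F : set_system S) (FF : Filter F) (g : S -> prod_topology T)
    (f : prod_topology T) :
  (forall i, (fun s => g s i) @ F --> f i) -> g @ F --> f.
Proof.
move=> h; apply/cvg_sup => i U.
rewrite nbhsE => -[V [[W oW <-] Wf] VU].
apply: filterS VU _.
apply: (h i); apply: open_nbhs_nbhs; split => //.
Qed.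

Lemma pointwise_eval_continuous (I : Type) (T : I -> topologicalType) (i : I) :
  continuous (fun f : prod_topology T => f i).
Proof.
move=> f; have /cvg_sup/(_ i) : f --> f by apply: cvg_id.
move=> h U; rewrite nbhsE => -[V [oV Vf] VU]; apply: h.
apply: (@filterS _ _ _ ((fun g : prod_topology T => g i) @^-1` V)); first by move=> ? /VU.
by apply: open_nbhs_nbhs; split => //; exists V.
Qed.

Lemma compact_bij_continuous (A B : topologicalType) (f : A -> B) (g : B -> A) :
  compact [set: A] -> hausdorff_space B -> continuous f ->
  (forall a, g (f a) = a) -> (forall b, f (g b) = b) -> continuous g.
Proof.
move=> cA hB cf gf fg; apply/continuous_closedP => C cC.
have -> : g @^-1` C = f @` C.
  rewrite eqEsubset; split => [b Cb|_ [a Ca <-]]; first by exists (g b).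
  by rewrite /preimage /= gf.
apply: compact_closed => //; apply: continuous_compact.
  exact: continuous_subspaceT.
by apply: (subclosed_compact cC cA).
Qed.

Lemma compact_setXT (A B : topologicalType) :
  compact [set: A] -> compact [set: B] -> compact [set: A * B].
Proof.
move=> cA cB; rewrite -setXTT; exact: compact_setX.
Qed.

Lemma set_type_compact (T : topologicalType) (A : set T) :
  compact A -> compact [set: set_type A].
Proof.
move=> cA F PF _.
have PG : ProperFilter (set_val @ F) by exact: fmap_proper_filter.
have [|x [Ax xF]] := cA _ PG.
  by apply: (@filterE _ F _ (set_val @^-1` A)) => x; exact: set_valP.
exists (SigSub (mem_set Ax)); split=> // U V FU.
rewrite nbhsE => -[_ [[W oW <-] Wx] WV].
have [|_ [[u Uu <-] Wu]] := xF (set_val @` U) W _ (open_nbhs_nbhs (conj oW Wx)).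
  by apply: (@filterS _ F _ U) => // u Uu; exists u.
by exists u; split=> //; exact: WV.
Qed.

Lemma set_type_cvg (T : topologicalType) (A : set T) (S : Type) (F : set_system S)
    (FF : Filter F) (g : S -> set_type A) (a : set_type A) :
  (fun s => set_val (g s)) @ F --> set_val a -> g @ F --> a.
Proof.
move=> h U; rewrite nbhsE => -[_ [[W oW <-] Wx] WV].
by apply: filterS WV _; apply: h; exact: open_nbhs_nbhs.
Qed.

Lemma set_val_continuous (T : topologicalType) (A : set T) :
  continuous (set_val : set_type A -> T).
Proof. exact: initial_continuous. Qed.

End Topology.

Section HilbertCube.
Variable R : realType.
Definition cube : ptopologicalType := hilbert_cube R.
Local Notation Q := cube.

Definition cube_coord (q : Q) (n : nat) : R := 2 * set_val ((q : hilbert_cube R) n) - 1.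

Lemma clamp01_subproof (x : R) : Num.max 0 (Num.min 1 ((x + 1) / 2)) \in `[0 : R, 1]%classic.
Proof. by rewrite inE/= in_itv/= le_max lexx ge_max ler01 ge_min lexx. Qed.

(** Clamping makes it total; it inverts [cube_coord] on sequences in [-1, 1]. *)
Definition cube_of (f : nat -> R) : Q := fun n => SigSub (clamp01_subproof (f n)).

Lemma cube_coord_bound q n : `|cube_coord q n| <= 1.
Proof.
rewrite /cube_coord; have := set_valP (q n); rewrite /= in_itv/= ler_norml.
rewrite -set_valE; set y := set_val _ => /andP[? ?].
by apply/andP; split; lra.
Qed.

Lemma cube_ofK f n : `|f n| <= 1 -> cube_coord (cube_of f) n = f n.
Proof.
rewrite ler_norml => /andP[h1 h2]; rewrite /cube_coord /cube_of set_valE /=.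
have -> : Num.min 1 ((f n + 1) / 2) = (f n + 1) / 2 by apply: min_r; lra.
have -> : Num.max 0 ((f n + 1) / 2) = (f n + 1) / 2 by apply: max_r; lra.
lra.
Qed.

Lemma cube_coord_inj q q' : (forall n, cube_coord q n = cube_coord q' n) -> q = q'.
Proof.
move=> h; apply: functional_extensionality_dep => n; apply: val_inj.
have := h n; rewrite /cube_coord => /addIr e; have two0 : (2 : R) != 0 by rewrite pnatr_eq0.
exact: (mulfI two0 e).
Qed.

Lemma cube_coord_continuous n : continuous (cube_coord ^~ n).
Proof.
have c2 : continuous (fun t : R => 2 * t - 1).
  move=> t; apply: cvgB; last exact: cvg_cst.
  by apply: cvgM; [exact: cvg_cst|exact: cvg_id].
move=> q; apply: (@continuous_comp Q R R (fun q : hilbert_cube R => set_val (q n))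
  (fun t : R => 2 * t - 1)); last exact: c2.
apply: (@continuous_comp Q (set_type `[0 : R, 1]%classic) R (fun q : hilbert_cube R => q n) set_val).
  exact: (@pointwise_eval_continuous _ (fun=> set_type `[0 : R, 1]%classic)).
exact: set_val_continuous.
Qed.

Lemma cvg_cube (S : Type) (F : set_system S) (FF : Filter F) (g : S -> Q) (q : Q) :
  (forall n, (fun s => cube_coord (g s) n) @ F --> cube_coord q n) -> g @ F --> q.
Proof.
move=> h; apply: cvg_pointwise => n; apply: set_type_cvg.
have -> : (fun s => set_val ((g s : hilbert_cube R) n)) = (fun s => 2^-1 * (cube_coord (g s) n + 1)).
  by apply/funext => s; rewrite /cube_coord; lra.
have -> : set_val (q n) = 2^-1 * (cube_coord q n + 1) by rewrite /cube_coord; lra.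
by apply: cvgM; [exact: cvg_cst|apply: cvgD; [exact: h|exact: cvg_cst]].
Qed.

Lemma cube_compact : compact [set: Q].
Proof.
have -> : [set: Q] = [set f | forall i, [set: set_type `[0 : R, 1]%classic] (f i)].
  by rewrite eqEsubset; split.
apply: (@tychonoff nat (fun=> set_type `[0 : R, 1]%classic) (fun=> setT)) => _.
apply: set_type_compact; exact: segment_compact.
Qed.

Lemma cube_hausdorff : hausdorff_space Q.
Proof.
apply: (@hausdorff_product nat (fun=> set_type `[0 : R, 1]%classic)) => _.
move=> x y xy; apply: val_inj; apply: (@Rhausdorff R) => U V Ux Vy.
have [||z [zU zV]] := xy (set_val @^-1` U) (set_val @^-1` V).
- exact: (@set_val_continuous R _ x).
- exact: (@set_val_continuous R _ y).
by exists (set_val z).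
Qed.

End HilbertCube.


(** * Stable form of Keller's theorem *)

Section Weight.
Variables (R : realType) (K : topologicalType) (x : nat -> K -> R).
Hypothesis x_continuous : forall i, continuous (x i).
Hypothesis x_bound : forall i k, `|x i k| <= 1.

(** A square is strictly convex in its coordinate; the summable factors turn countably many squares
    into one continuous function, strictly convex as soon as the [x i] separate points. *)
Definition energy_sum N k : R := \sum_(i < N) 2^-1 ^+ i.+1 * x i k ^+ 2.
Definition energy k : R := limn (energy_sum ^~ k).
Definition weight k : R := 2 - energy k.

Lemma sqr_x_bound i k : 0 <= x i k ^+ 2 <= 1.
Proof. by rewrite sqr_ge0 /= -real_normK ?num_real// expr_le1. Qed.

Lemma energy_sumS N k :
  energy_sum N.+1 k = energy_sum N k + 2^-1 ^+ N.+1 * x N k ^+ 2.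
Proof. by rewrite /energy_sum big_ord_recr. Qed.

Lemma half_exp_gt0 n : 0 < (2^-1 : R) ^+ n.
Proof. by rewrite exprn_gt0// invr_gt0. Qed.

Lemma half_exp_ge0 n : 0 <= (2^-1 : R) ^+ n.
Proof. exact: ltW (half_exp_gt0 n). Qed.

Lemma energy_sum_nondecreasing k : nondecreasing_seq (energy_sum ^~ k).
Proof.
apply/nondecreasing_seqP => N; rewrite energy_sumS lerDl.
by rewrite mulr_ge0 ?half_exp_ge0//; have /andP[] := sqr_x_bound N k.
Qed.

(** The new term is at most [2^-1 ^+ N.+1], exactly what the remainder loses in one step. The
    resulting error bound is uniform in [k], which makes [energy] continuous. *)
Lemma energy_sum_tail k :
  nonincreasing_seq (fun N => energy_sum N k + 2^-1 ^+ N).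
Proof.
apply/nonincreasing_seqP => N; rewrite energy_sumS exprS.
have := half_exp_gt0 N; have /andP[] := sqr_x_bound N k.
set y := x N k ^+ 2; set h := 2^-1 ^+ N => ? ? ?; nra.
Qed.

Lemma energy_cvg k : energy_sum ^~ k @ \oo --> energy k.
Proof.
apply: (nondecreasing_is_cvgn (@energy_sum_nondecreasing k)).
exists 1 => _ [N _ <-].
have := energy_sum_tail k (leq0n N).
rewrite /energy_sum big_ord0 add0r expr0 => h.
by apply: le_trans h; rewrite lerDl half_exp_ge0.
Qed.

Lemma energy_bounds N k : energy_sum N k <= energy k <= energy_sum N k + 2^-1 ^+ N.
Proof.
have c := @energy_cvg k; apply/andP; split.
  apply: limr_ge; first exact: cvgP c.
  by near=> M; apply: energy_sum_nondecreasing; near: M; exact: nbhs_infty_ge.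
apply: limr_le; first exact: cvgP c.
near=> M; apply: (@le_trans _ _ (energy_sum M k + 2^-1 ^+ M)).
  by rewrite lerDl half_exp_ge0.
by apply: energy_sum_tail; near: M; exact: nbhs_infty_ge.
Unshelve. all: by end_near. Qed.

Lemma energy_sum_continuous N : continuous (energy_sum N).
Proof.
elim: N => [|N IH] k.
  have -> : energy_sum 0 = cst 0 by apply/funext => ?; rewrite /energy_sum big_ord0.
  exact: cvg_cst.
have -> : energy_sum N.+1 = (fun k => energy_sum N k + 2^-1 ^+ N.+1 * (x N k * x N k)).
  by apply/funext => ?; rewrite energy_sumS expr2.
apply: cvgD; first exact: IH.
by apply: cvgM; [exact: cvg_cst|apply: cvgM; exact: x_continuous].
Qed.

Lemma energy_continuous : continuous energy.
Proof.
move=> k; apply/cvgrPdist_lt => e e0.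
have [N hN] : exists N, (2^-1 : R) ^+ N < e / 3.
  have /cvgrPdist_lt/(_ (e / 3)) : (fun n => (2^-1 : R) ^+ n) @ \oo --> (0 : R).
    by apply: cvg_expr; rewrite ger0_norm ?invr_ge0// invf_lt1// ltr1n.
  rewrite divr_gt0// => /(_ isT) [N _ /(_ N (leqnn N))]; rewrite /= sub0r normrN.
  by move=> /(le_lt_trans (ler_norm _)) ?; exists N.
have /cvgrPdist_lt/(_ (e / 3)) := @energy_sum_continuous N k.
rewrite divr_gt0// => /(_ isT); apply: filterS => k' /=.
have := energy_bounds N k; have := energy_bounds N k'.
rewrite !ltr_distl => /andP[? ?] /andP[? ?] /andP[? ?]; apply/andP; split; lra.
Qed.

Lemma weight_continuous : continuous weight.
Proof.
move=> k; rewrite /continuous_at /weight; apply: cvgB; first exact: cvg_cst.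
exact: energy_continuous.
Qed.

Lemma weight_bounds k : 1 <= weight k <= 2.
Proof.
have := energy_bounds 0 k; rewrite /energy_sum big_ord0 expr0 => /andP[? ?].
by rewrite /weight; apply/andP; split; lra.
Qed.

Lemma weight_gt0 k : 0 < weight k.
Proof. by have /andP[/(lt_le_trans ltr01)] := weight_bounds k. Qed.

Lemma defect_ge0 (l y : R) n : 0 <= l -> l <= 1 ->
  0 <= l * (1 - l) * (2^-1 ^+ n * y ^+ 2).
Proof.
move=> l0 l1; apply: mulr_ge0; apply: mulr_ge0; rewrite ?subr_ge0 ?half_exp_ge0//.
exact: sqr_ge0.
Qed.

Section concavity.
Variables (k k' m : K) (l : R).
Hypothesis l01 : 0 <= l <= 1.
Hypothesis mix : forall i, x i m = (1 - l) * x i k + l * x i k'.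

(** From the identity ((1 - l) a + l b)^2 + l (1 - l) (a - b)^2 = (1 - l) a^2 + l b^2 in each
    coordinate. The defect of one fixed coordinate [i] is kept so that strictness survives the limit
    of the partial sums. *)
Lemma weight_concave_defect i :
  (1 - l) * weight k + l * weight k' +
    l * (1 - l) * (2^-1 ^+ i.+1 * (x i k - x i k') ^+ 2) <= weight m.
Proof.
set defect := l * (1 - l) * _.
suff : energy m <= (1 - l) * energy k + l * energy k' - defect by rewrite /weight; lra.
have fin N : (i < N)%N ->
    energy_sum N m <= (1 - l) * energy_sum N k + l * energy_sum N k' - defect.
  move=> iN; rewrite lerBrDr /energy_sum !mulr_sumr -big_split /=.
  rewrite (bigD1 (Ordinal iN))//= [leRHS](bigD1 (Ordinal iN))//= addrAC.
  have /andP[l0 l1] := l01.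
  have key j : 2^-1 ^+ j.+1 * x j m ^+ 2 + l * (1 - l) * (2^-1 ^+ j.+1 * (x j k - x j k') ^+ 2)
     = (1 - l) * (2^-1 ^+ j.+1 * x j k ^+ 2) + l * (2^-1 ^+ j.+1 * x j k' ^+ 2).
    by rewrite mix; ring.
  apply: lerD; first by rewrite key.
  apply: ler_sum => j _; rewrite -key lerDl.
  exact: defect_ge0.
apply: (ler_cvg_to (@energy_cvg m)
  (g := fun N => (1 - l) * energy_sum N k + l * energy_sum N k' - defect)); last first.
  by exists i.+1 => //= N /fin; exact.
apply: cvgB; last exact: cvg_cst.
by apply: cvgD; (apply: cvgM; [exact: cvg_cst|exact: energy_cvg]).
Qed.

Lemma weight_concave : (1 - l) * weight k + l * weight k' <= weight m.
Proof.
apply: le_trans (weight_concave_defect 0); rewrite lerDl.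
have /andP[l0 l1] := l01.
exact: defect_ge0.
Qed.

End concavity.

Lemma weight_strictly_concave k k' m l : 0 < l < 1 ->
  (forall i, x i m = (1 - l) * x i k + l * x i k') ->
  (exists i, x i k != x i k') -> (1 - l) * weight k + l * weight k' < weight m.
Proof.
move=> /andP[l0 l1] mix [i ne].
apply: lt_le_trans (weight_concave_defect _ mix i); last by rewrite !ltW.
rewrite ltrDl; apply: mulr_gt0; apply: mulr_gt0; rewrite ?subr_gt0 ?half_exp_gt0//.
by rewrite exprn_even_gt0//= subr_eq0.
Qed.

End Weight.

(** * The homeomorphism of K * Q * Q with Q *)

Section StableKeller.
Variables (R : realType) (K : topologicalType) (x : nat -> K -> R).
Hypothesis K_compact : compact [set: K].
Hypothesis x_continuous : forall i, continuous (x i).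
Hypothesis x_bound : forall i k, `|x i k| <= 1.
Hypothesis x_inj : forall k k', (forall i, x i k = x i k') -> k = k'.
Hypothesis x_convex : forall k k' (l : R), 0 <= l <= 1 ->
  exists m, forall i, x i m = (1 - l) * x i k + l * x i k'.

Local Notation w := (weight x).
Local Notation A := (K * cube R)%type.

Definition pair_code (n k : nat) : nat := Cantor.to_nat (n, k).
Definition code_row (j : nat) : nat := (Cantor.of_nat j).1.
Definition code_column (j : nat) : nat := (Cantor.of_nat j).2.

Lemma pair_codeK j : pair_code (code_row j) (code_column j) = j.
Proof. by rewrite /pair_code /code_row /code_column -surjective_pairing Cantor.cancel_to_of. Qed.

Lemma code_rowK n k : code_row (pair_code n k) = n.
Proof. by rewrite /code_row /pair_code Cantor.cancel_of_to. Qed.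

Lemma code_columnK n k : code_column (pair_code n k) = k.
Proof. by rewrite /code_column /pair_code Cantor.cancel_of_to. Qed.

Lemma le_pair_code n k : (k <= pair_code n k)%N.
Proof.
have /ssrnat.leP := Cantor.to_nat_non_decreasing n k; apply: leq_trans.
exact: leq_addr.
Qed.

Definition tilt_scale (n : nat) : R := n.+1%:R^-1.

Lemma tilt_scale_gt0 n : 0 < tilt_scale n.
Proof. by rewrite invr_gt0 ltr0n. Qed.

Lemma tilt_scaleK n r : tilt_scale n * (r / tilt_scale n) = r.
Proof. by rewrite mulrC divfK// gt_eqF// tilt_scale_gt0. Qed.

(* Every [x i] occurs in infinitely many [tilt n], with perturbations tending to
   zero, so the [tilt n] separate points; but each finite family of them can be
   moved freely, through the cube coordinates alone, at a point where these are
   strictly between their bounds. *)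
Definition tilt (n : nat) (a : A) : R := x (code_row n) a.1 + tilt_scale n * (w a.1 * cube_coord a.2 n).

Lemma tilt_continuous n : continuous (tilt n).
Proof.
move=> a; rewrite /continuous_at /tilt; apply: cvgD.
  exact: (@continuous_comp _ _ _ fst (x (code_row n)) a cvg_fst (@x_continuous _ _)).
apply: cvgM; first exact: cvg_cst.
apply: cvgM.
  by apply: (@continuous_comp _ _ _ fst w a cvg_fst); apply: weight_continuous.
apply: (@continuous_comp _ _ _ snd (fun q : cube R => cube_coord q n)); first exact: cvg_snd.
exact: cube_coord_continuous.
Qed.

(** A difference in coordinate [i] on [K] would show up in every [tilt n] of row [i], up to a
    perturbation that tends to zero. Once the K-parts agree, [tilt n] determines the [n]-th cube
    coordinate, as its factor is positive. *)
Lemma tilt_inj a b : (forall n, tilt n a = tilt n b) -> a = b.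
Proof.
move=> e; have k1 : a.1 = b.1.
  apply: x_inj => i; apply/eqP; rewrite -subr_eq0 -normr_le0 leNgt; apply/negP => d0.
  set d := `|_| in d0.
  (* The 4 bounds the difference of the two perturbations: weights are at most 2 and cube
     coordinates at most 1 in absolute value. The code of [(i, N)] is at least [N], so its scale
     beats [d / 4]. *)
  pose N := Num.truncn (4 / d); pose n := pair_code i N.
  have nd : 4 < n.+1%:R * d.
    rewrite -ltr_pdivrMr//; apply: lt_le_trans (truncnS_gt _) _.
    by rewrite ler_nat ltnS le_pair_code.
  have := e n; rewrite /tilt /n code_rowK -/n => eq.
  have dE : x i a.1 - x i b.1 = tilt_scale n * (w b.1 * cube_coord b.2 n - w a.1 * cube_coord a.2 n) by lra.
  have : d <= tilt_scale n * 4.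
    rewrite /d dE normrM (ger0_norm (ltW (tilt_scale_gt0 n))) ler_pM2l ?tilt_scale_gt0//.
    apply: le_trans (ler_normB _ _) _; rewrite !normrM.
    rewrite !(gtr0_norm (weight_gt0 _ _))//.
    have := weight_bounds x_bound a.1; have := weight_bounds x_bound b.1.
    have := cube_coord_bound a.2 n; have := cube_coord_bound b.2 n.
    have := normr_ge0 (cube_coord a.2 n); have := normr_ge0 (cube_coord b.2 n).
    by move=> ? ? ? ? /andP[? ?] /andP[? ?]; nra.
  by rewrite /tilt_scale mulrC ler_pdivlMr// ?ltr0n// mulrC leNgt nd.
case: a b e k1 => a1 a2 [b1 b2] e /= k1; rewrite -k1 in e *; congr pair.
apply: cube_coord_inj => n; have := e n; rewrite /tilt /= => /addrI.
by move=> /(mulfI (lt0r_neq0 (tilt_scale_gt0 n)))/(mulfI (lt0r_neq0 (weight_gt0 x_bound a1))).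
Qed.

(** Mixing the products weight times coordinate costs at most the mixture of the two weights, while
    the weight at [k] is larger. The difference is the room left for [v], in all coordinates
    simultaneously. *)
Lemma mix_with_slack a b l : 0 <= l <= 1 -> exists2 k,
    (forall i, x i k = (1 - l) * x i a.1 + l * x i b.1) &
    forall v : nat -> R,
      (forall n, `|v n| <= w k - ((1 - l) * w a.1 + l * w b.1)) ->
      exists m, forall n, tilt n m = (1 - l) * tilt n a + l * tilt n b + tilt_scale n * v n.
Proof.
move=> l01; have [k kE] := x_convex a.1 b.1 l01; exists k => // v vb.
have wk := weight_gt0 x_bound k.
pose t n := (1 - l) * (w a.1 * cube_coord a.2 n) + l * (w b.1 * cube_coord b.2 n) + v n.
have /andP[l0 l1] := l01.
have tb n : `|t n / w k| <= 1.
  rewrite normrM normfV (gtr0_norm wk) ler_pdivrMr// mul1r.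
  apply: (@le_trans _ _ ((1 - l) * w a.1 + l * w b.1 + `|v n|)); last by have := vb n; lra.
  apply: le_trans (ler_normD _ _) _; rewrite lerD2r.
  apply: le_trans (ler_normD _ _) _; rewrite !normrM !(gtr0_norm (weight_gt0 _ _))//.
  rewrite (ger0_norm l0) ger0_norm ?subr_ge0//.
  by apply: lerD; rewrite ler_wpM2l ?subr_ge0// ler_piMr ?cube_coord_bound// ltW// weight_gt0.
exists (k, cube_of (fun n => t n / w k)) => n.
have tE : w k * (t n / w k) = t n by rewrite mulrC divfK ?gt_eqF.
by rewrite /tilt /= cube_ofK// kE tE /t; ring.
Qed.

Lemma tilt_convex a b l : 0 <= l <= 1 ->
  exists m, forall n, tilt n m = (1 - l) * tilt n a + l * tilt n b.
Proof.
move=> l01; have [k kE mv] := mix_with_slack a b l01.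
have [n|m mE] := mv (fun=> 0).
  by rewrite normr0 subr_ge0; exact: weight_concave.
by exists m => n; rewrite mE mulr0 addr0.
Qed.

Lemma A_compact : compact [set: A].
Proof. by apply: compact_setXT => //; exact: cube_compact. Qed.

Definition fiber n (a : A) : set A := [set b | forall i, (i < n)%N -> tilt i b = tilt i a].

Lemma fiber_eq n a b : fiber n a b -> fiber n b = fiber n a.
Proof.
move=> ab; rewrite eqEsubset; split=> c h i ij; first by rewrite h// ab.
by rewrite h// ab.
Qed.

Lemma fiberxx n a : fiber n a a. Proof. by []. Qed.

(** Used with [s = 1] for the upper end point of the admissible values of [tilt n], and with
    [s = -1] for minus the lower one. *)
Definition height (s : R) n a : R := sup [set s * tilt n b | b in fiber n a].

Lemma fiber_compact n a : compact (fiber n a).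
Proof.
apply: (subclosed_compact _ A_compact) => //.
have -> : fiber n a = \bigcap_(i in [set i | (i < n)%N]) (tilt i @^-1` [set tilt i a]).
  by rewrite eqEsubset; split.
apply: closed_bigI => i _; have /continuous_closedP := @tilt_continuous i; apply.
exact: closed_eq.
Qed.

Lemma height_attained s n a : exists2 b, fiber n a b &
  s * tilt n b = height s n a /\ forall c, fiber n a c -> s * tilt n c <= height s n a.
Proof.
have sy : {within fiber n a, continuous (fun b => s * tilt n b)}.
  apply: continuous_subspaceT => b; apply: cvgM; first exact: cvg_cst.
  exact: tilt_continuous.
have fn0 : fiber n a !=set0 by exists a.
have [b /set_mem fb hb] := compact_EVT_max fn0 (@fiber_compact n a) sy.
have ub c : fiber n a c -> s * tilt n c <= s * tilt n b by move=> fc; exact/hb/mem_set.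
have hE : s * tilt n b = height s n a.
  apply/eqP; rewrite eq_le; apply/andP; split.
    apply: ub_le_sup; last by exists b.
    by exists (s * tilt n b) => _ [c fc <-]; exact: ub.
  apply: ge_sup; first by exists (s * tilt n b), b.
  by move=> _ [c fc <-]; exact: ub.
by exists b => //; split=> // c /ub; rewrite hE.
Qed.

Lemma height_ge s n a b : fiber n a b -> s * tilt n b <= height s n a.
Proof. by have [c _ [_]] := height_attained s n a; exact. Qed.

Lemma height_fiber s n a b : fiber n a b -> height s n b = height s n a.
Proof. by move=> /fiber_eq; rewrite /height => ->. Qed.

(** Compactness of [A]: each [c] has a neighbourhood on which, for [b] near [a], either some earlier
    tilt keeps its points out of the fibre of [b], or [s * tilt n] stays below the bound. *)
Lemma height_usc s n a e : 0 < e -> \forall b \near a, height s n b < height s n a + e.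
Proof.
move=> e0.
have /compact_near_coveringP cov := A_compact.
have : \forall b \near a, [set: A] `<=`
    [set c | (forall i, (i < n)%N -> tilt i c = tilt i b) -> s * tilt n c < height s n a + e].
  apply: (cov A (nbhs a) (fun b c =>
    (forall i, (i < n)%N -> tilt i c = tilt i b) -> s * tilt n c < height s n a + e)) => c _.
  have [fc|/existsNP[i /not_implyP[ij /eqP ne]]] := pselect (fiber n a c).
    have : \forall c' \near c, s * tilt n c' < height s n a + e.
      have cc : (fun c' => s * tilt n c') @ c --> s * tilt n c.
        by apply: cvgM; [exact: cvg_cst|exact: tilt_continuous].
      apply: (cvgr_lt _ cc); apply: le_lt_trans (height_ge s fc) _.
      by rewrite ltrDl.
    move=> h; exists ([set c' | s * tilt n c' < height s n a + e], setT).
      by split => //; exact: filterT.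
    by move=> [c' b] /= [h' _] _.
  have d0 : 0 < `|tilt i c - tilt i a| / 2 by rewrite divr_gt0// normr_gt0 subr_eq0.
  have /cvgrPdist_lt/(_ _ d0) hc := @tilt_continuous i c.
  have /cvgrPdist_lt/(_ _ d0) ha := @tilt_continuous i a.
  exists ([set c' | `|tilt i c - tilt i c'| < `|tilt i c - tilt i a| / 2],
          [set b | `|tilt i a - tilt i b| < `|tilt i c - tilt i a| / 2]); first by split.
  move=> [c' b] /= [h1 h2] /(_ i ij) e'; exfalso.
  have : `|tilt i c - tilt i a| <= `|tilt i c - tilt i c'| + `|tilt i b - tilt i a|.
    by rewrite e' -{1}(subrKA (tilt i b)) ler_normD.
  by rewrite (distrC (tilt i b)); lra.
apply: filterS => b h; have [c fc [<- _]] := height_attained s n b.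
by apply: h.
Qed.

Lemma height_lsc s n a e : `|s| = 1 -> 0 < e ->
  \forall b \near a, height s n a - e < height s n b.
Proof.
move=> s1 e0; have [z fz [zE zub]] := height_attained s n a.
(* If the fibre meets two points of [K], strict concavity of the weight leaves
   room around their mixtures; otherwise the maximum is explicit. *)
have [[c fc cz]|uniq] := pselect (exists2 c, fiber n a c & c.1 <> z.1).
  pose D := height s n a - s * tilt n c.
  have D0 : 0 <= D by rewrite subr_ge0; exact: zub.
  (* Close enough to 1 that moving from the maximiser [z] towards [c] costs [(1 - l) * D < e], yet
     below 1, so that strict concavity gives slack. Adding [e] to [D] covers the case [D = 0]. *)
  pose l := 1 - e / (2 * (D + e)).
  have h1 : 0 < e / (2 * (D + e)) by rewrite divr_gt0// mulr_gt0// ltr_wpDl.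
  have h2 : e / (2 * (D + e)) <= 2^-1.
    by rewrite ler_pdivrMr ?mulr_gt0 ?ltr_wpDl//; lra.
  have l01 : 0 < l < 1 by rewrite /l; apply/andP; split; lra.
  have l01' : 0 <= l <= 1 by have /andP[? ?] := l01; rewrite !ltW.
  have [k kE mv] := mix_with_slack c z l01'.
  pose d := w k - ((1 - l) * w c.1 + l * w z.1).
  have d0 : 0 < d.
    rewrite subr_gt0; apply: (weight_strictly_concave x_bound l01 kE).
    apply: contrapT => h; apply: cz; apply: x_inj => i.
    by apply/eqP/negPn/negP => ne; apply: h; exists i.
  have near_y : \forall b \near a, forall i : 'I_n, `|tilt i a - tilt i b| < tilt_scale i * d.
    apply: (@filter_forall A 'I_n (fun i => [set b : A | `|tilt i a - tilt i b| < tilt_scale i * d])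
      (nbhs a) (nbhs_filter a)) => i.
    have /cvgrPdist_lt := @tilt_continuous i a; apply.
    by rewrite mulr_gt0// tilt_scale_gt0.
  apply: filterS near_y => b hb.
  (* The correction moves the first [n] values from those of [a] to those of [b] and leaves the
     value at [n] alone, so [m] lies in the fibre of [b] and is almost maximal. *)
  pose v i := if (i < n)%N then (tilt i b - tilt i a) / tilt_scale i else 0.
  have [i|m mE] := mv v.
    rewrite /v; case: ifPn => [ij|_]; last by rewrite normr0 ltW.
    rewrite normrM normfV (gtr0_norm (tilt_scale_gt0 i)) ler_pdivrMr ?tilt_scale_gt0//.
    by rewrite distrC mulrC ltW// (hb (Ordinal ij)).
  have fm : fiber n b m.
    move=> i ij; rewrite mE /v ij tilt_scaleK.
    by rewrite fc// fz//; ring.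
  apply: lt_le_trans (height_ge s fm).
  rewrite mE /v ltnn mulr0 addr0.
  have -> : s * ((1 - l) * tilt n c + l * tilt n z) = height s n a - (1 - l) * D.
    by rewrite /D -zE; ring.
  have : (1 - l) * D < e.
    rewrite /l opprB addrCA subrr addr0 mulrAC ltr_pdivrMr ?mulr_gt0 ?ltr_wpDl//.
    by nra.
  by lra.
have fz1 c : fiber n a c -> c.1 = z.1.
  by move=> fc; apply: contrapT => cz; apply: uniq; exists c.
(* Setting the [n]-th cube coordinate of [b] to [s] stays in its fibre and gives the value [H b], a
   lower bound everywhere. At [a] it is also an upper bound, since all points of that fibre share
   one K-part. *)
pose H (b : A) := s * x (code_row n) b.1 + tilt_scale n * w b.1.
have cH : H @ a --> H a.
  apply: cvgD; apply: cvgM; try exact: cvg_cst.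
    exact: (@continuous_comp _ _ _ fst (x (code_row n)) a cvg_fst (@x_continuous _ _)).
  by apply: (@continuous_comp _ _ _ fst w a cvg_fst); apply: weight_continuous.
have Hge b : H b <= height s n b.
  pose b' : A := (b.1, cube_of (fun i => if i == n then s else cube_coord b.2 i)).
  have cb i : `|if i == n then s else cube_coord b.2 i| <= 1.
    by case: ifP => _; [rewrite s1|exact: cube_coord_bound].
  have fb : fiber n b b'.
    by move=> i ij; rewrite /tilt /= cube_ofK ?cb// ltn_eqF.
  apply: le_trans (height_ge s fb); rewrite /tilt /= cube_ofK ?cb// eqxx /H.
  have ss : s * s = 1 by rewrite -expr2 -real_normK ?num_real// s1 expr1n.
  rewrite [leRHS]mulrDr lerD2l.
  have -> : s * (tilt_scale n * (w b.1 * s)) = (s * s) * (tilt_scale n * w b.1) by ring.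
  by rewrite ss mul1r.
have Ha : height s n a <= H a.
  rewrite -zE /H /tilt (fz1 a (@fiberxx n a)) [leLHS]mulrDr lerD2l.
  apply: le_trans (ler_norm _) _; rewrite !normrM s1 mul1r.
  rewrite (gtr0_norm (tilt_scale_gt0 n)) ler_pM2l ?tilt_scale_gt0//.
  rewrite gtr0_norm ?weight_gt0//.
  by rewrite ler_piMr ?cube_coord_bound// ltW// weight_gt0.
have lt_H : height s n a - e < H a by lra.
have : \forall b \near a, height s n a - e < H b by exact: (cvgr_gt (H a) cH).
by apply: filterS => b /lt_le_trans; apply.
Qed.

Lemma height_continuous s n : `|s| = 1 -> continuous (height s n).
Proof.
move=> s1 a; apply/cvgrPdist_lt => e e0.
have h1 := height_usc s n a e0; have h2 := height_lsc n a s1 e0.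
apply: filterS2 h1 h2 => b h1 h2.
by rewrite ltr_distl; apply/andP; split; lra.
Qed.

Definition gap n a : R := height 1 n a + height (-1) n a.
Definition excess n a : R := tilt n a + height (-1) n a.

Lemma excess_bounds n a : 0 <= excess n a <= gap n a.
Proof.
have := height_ge 1 (@fiberxx n a); have := height_ge (-1) (@fiberxx n a).
by rewrite /excess /gap mul1r mulN1r => ? ?; apply/andP; split; lra.
Qed.

Lemma gap_ge0 n a : 0 <= gap n a.
Proof. by have /andP[/le_trans] := excess_bounds n a; apply. Qed.

Lemma gap_continuous n : continuous (gap n).
Proof.
by move=> a; apply: cvgD; apply: height_continuous; rewrite ?normrN normr1.
Qed.

Lemma excess_continuous n : continuous (excess n).
Proof.
move=> a; apply: cvgD; first exact: tilt_continuous.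
by apply: height_continuous; rewrite normrN normr1.
Qed.

Lemma gap_fiber n a b : fiber n a b -> gap n b = gap n a.
Proof. by move=> f; rewrite /gap !(height_fiber _ f). Qed.

(** Convexity: the point is the mixture of a minimiser and a maximiser in ratio [s / gap n a], which
    requires a nonzero gap; otherwise [a] itself serves. *)
Lemma excess_surj n a s : 0 <= s <= gap n a -> exists2 b, fiber n a b & excess n b = s.
Proof.
have [t ft [tE tub]] := height_attained 1 n a.
have [b fb [bE bub]] := height_attained (-1) n a.
move=> /andP[s0 sg].
have [g0|g0] := eqVneq (gap n a) 0.
  exists a => //; apply/eqP; have /andP[] := excess_bounds n a; rewrite g0 => e0 e1.
  by rewrite eq_le; apply/andP; split; [apply: le_trans s0|apply: le_trans e0; rewrite -g0].
have gp : 0 < gap n a by rewrite lt_neqAle eq_sym g0 gap_ge0.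
have l01 : 0 <= s / gap n a <= 1.
  by rewrite divr_ge0 ?gap_ge0//= ler_pdivrMr// mul1r.
have [m mE] := tilt_convex b t l01.
have fm : fiber n a m.
  by move=> i ij; rewrite mE fb// ft//; ring.
exists m => //; rewrite /excess (height_fiber _ fm) mE.
have -> : tilt n t = height 1 n a by rewrite -tE mul1r.
have -> : tilt n b = - height (-1) n a by rewrite -bE mulN1r opprK.
have sE : s / gap n a * gap n a = s by rewrite divfK.
by rewrite -[RHS]sE /gap; ring.
Qed.

(** The second cube is split into countably many sequences, one for each interval to be absorbed. *)
Definition slice (q : cube R) n : nat -> R := fun k => cube_coord q (pair_code n k).

Definition absorb_row n (p : A * cube R) k : R :=
  absorb (gap n p.1) (excess n p.1) (slice p.2 n) k.

Definition straighten (p : A * cube R) : cube R :=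
  cube_of (fun j => absorb_row (code_row j) p (code_column j)).

Lemma absorb_row_bound n p k : `|absorb_row n p k| <= 1.
Proof. by apply: absorb_bound; [exact: excess_bounds|move=> j; exact: cube_coord_bound]. Qed.

Lemma straightenE p n k : cube_coord (straighten p) (pair_code n k) = absorb_row n p k.
Proof. by rewrite cube_ofK ?absorb_row_bound// code_rowK code_columnK. Qed.

Lemma straighten_continuous : continuous straighten.
Proof.
move=> p; apply: cvg_cube => j; rewrite -(pair_codeK j).
rewrite straightenE.
under eq_fun do rewrite straightenE.
apply: cvg_absorb; last exact: gap_ge0.
- apply: (@continuous_comp _ _ _ fst (gap (code_row j))); first exact: cvg_fst.
  exact: gap_continuous.
- apply: (@continuous_comp _ _ _ fst (excess (code_row j))); first exact: cvg_fst.
  exact: excess_continuous.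
- move=> k; apply: (@continuous_comp _ _ _ snd (fun q : cube R => cube_coord q _)).
    exact: cvg_snd.
  exact: cube_coord_continuous.
Qed.

(** Induction on [n]: once the first [n] tilts agree, the two points have the same gap and the same
    lower end point, so [absorb_inj] on row [n] yields the next tilt and row [n] of the second
    cube. *)
Lemma straighten_inj p p' : straighten p = straighten p' -> p = p'.
Proof.
move=> e.
have er n k : absorb_row n p k = absorb_row n p' k by rewrite -!straightenE e.
have step n : fiber n p.1 p'.1 ->
    tilt n p.1 = tilt n p'.1 /\ forall k, slice p.2 n k = slice p'.2 n k.
  move=> f; have gE := gap_fiber f.
  have := excess_bounds n p'.1; rewrite gE => b'.
  have [|es eq] := absorb_inj (excess_bounds n p.1) b' (q := slice p.2 n) (q' := slice p'.2 n).
    by move=> k; have := er n k; rewrite /absorb_row gE.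
  split=> //; move: es; rewrite /excess (height_fiber _ f); exact: addIr.
have ff n : fiber n p.1 p'.1.
  elim: n => [//|n IH] i; rewrite ltnS leq_eqVlt => /predU1P[->|]; last exact: IH.
  by have [] := step n IH.
have e1 : p.1 = p'.1 by apply: tilt_inj => n; have [] := step n (ff n).
have e2 : p.2 = p'.2.
  apply: cube_coord_inj => j; rewrite -(pair_codeK j).
  by have [_] := step (code_row j) (ff _); apply.
by case: p p' e1 e2 {e er step ff} => a q [a' q'] /= -> ->.
Qed.

(** Row [n] depends on the point of [A] only through the tilts of index at most [n]. Moving that
    point inside its fibre of level [N] and rewriting row [N] of the second cube therefore preserves
    all earlier rows. *)
Lemma straighten_approx (p0 : A * cube R) (o : cube R) N : exists p : A * cube R,
  forall n k, (n < N)%N -> absorb_row n p k = cube_coord o (pair_code n k).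
Proof.
elim: N => [|N [[a q] IH]]; first by exists p0.
have [s [r [sb rb rE]]] := absorb_surj (gap_ge0 N a)
  (fun k => cube_coord_bound o (pair_code N k)).
have [b fb bE] := excess_surj sb.
pose q' : cube R := cube_of (fun j => if code_row j == N then r (code_column j) else cube_coord q j).
have qE n : slice q' n = if n == N then r else slice q n.
  apply/funext => k; rewrite /slice /q' cube_ofK code_rowK ?code_columnK; last first.
    by case: ifP => _; [exact: rb|exact: cube_coord_bound].
  by case: ifP.
exists (b, q') => n k; rewrite ltnS leq_eqVlt => /predU1P[->|nN].
  by rewrite /absorb_row /= qE eqxx (gap_fiber fb) bE rE.
have fn : fiber n a b by move=> i ij; apply: fb; exact: ltn_trans nN.
rewrite -(IH n k nN) /absorb_row /= qE (ltn_eqF nN) (gap_fiber fn) /excess.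
by rewrite (height_fiber _ fn) fb.
Qed.

Lemma straighten_surj (p0 : A * cube R) (o : cube R) : exists p, straighten p = o.
Proof.
have [u uE] := choice (straighten_approx p0 o).
have cAQ : compact [set: A * cube R].
  by apply: compact_setXT; [exact: A_compact|exact: cube_compact].
(* Each output coordinate is eventually constant along [u], so by continuity it has the prescribed
   value at a cluster point. *)
have [|p [_ clp]] := cAQ (u @ \oo); first exact: filterT.
exists p; apply: cube_coord_inj => j; rewrite -(pair_codeK j) straightenE.
move: (code_row j) (code_column j) => n k; apply: (@Rhausdorff R) => U V nU nV.
have [||z [zE zU]] := clp [set p | absorb_row n p k = cube_coord o (pair_code n k)]
    ((fun p => cube_coord (straighten p) (pair_code n k)) @^-1` U).
- by exists n.+1 => //= N nN; rewrite /= uE.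
- apply: (@continuous_comp _ _ _ straighten (fun q : cube R => cube_coord q (pair_code n k)) p).
  + exact: straighten_continuous.
  + exact: cube_coord_continuous.
  + by rewrite /= straightenE.
exists (cube_coord o (pair_code n k)); split; last exact: nbhs_singleton.
by rewrite -zE -straightenE.
Qed.

Theorem stable_keller : K -> exists (f : A * cube R -> cube R) (g : cube R -> A * cube R),
  [/\ continuous f, continuous g, cancel f g & cancel g f].
Proof.
move=> k0; pose p0 : A * cube R := ((k0, point), point).
have [g gE] := choice (straighten_surj p0).
have fK : cancel straighten g by move=> p; apply: straighten_inj; rewrite gE.
exists straighten, g; split => //; first exact: straighten_continuous.
apply: compact_bij_continuous straighten_continuous fK gE.
- by apply: compact_setXT; [exact: A_compact|exact: cube_compact].
- exact: cube_hausdorff.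
Qed.

End StableKeller.

(** * States *)

Section ClosedSets.
Context {T : topologicalType}.

Lemma closed_forall (I : Type) (A : I -> set T) :
  (forall i, closed (A i)) -> closed [set t | forall i, A i t].
Proof.
move=> cA; have -> : [set t | forall i, A i t] = \bigcap_(i in setT) A i.
  by rewrite eqEsubset; split=> t h i; [move=> _|]; exact: h.
by apply: closed_bigI => i _; exact: cA.
Qed.

Lemma closed_imply (P : Prop) (A : set T) :
  (P -> closed A) -> closed [set t | P -> A t].
Proof.
move=> cA; have [p|np] := pselect P.
  have -> : [set t | P -> A t] = A; last exact: cA.
  by rewrite eqEsubset; split=> t /= h; [exact: h p|].
have -> : [set t | P -> A t] = setT by rewrite eqEsubset; split=> t //= _ /np.
exact: closedT.
Qed.

Lemma closed_eq_fun (R : realType) (f g : T -> R) :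
  continuous f -> continuous g -> closed [set t | f t = g t].
Proof.
move=> cf cg; have -> : [set t | f t = g t] = (fun t => f t - g t) @^-1` [set 0].
  rewrite eqEsubset; split=> t /=; first by move=> ->; rewrite subrr.
  by move=> /eqP; rewrite subr_eq0 => /eqP.
have cfg : continuous (fun t => f t - g t).
  by move=> t; apply: cvgB; [exact: cf|exact: cg].
by move/continuous_closedP : cfg; apply; exact: closed_eq.
Qed.

Lemma closed_ge0_fun (R : realType) (f : T -> R) :
  continuous f -> closed [set t | 0 <= f t].
Proof. by move=> /continuous_closedP cf; apply: (cf [set r | 0 <= r]); exact: closed_ge. Qed.

End ClosedSets.

Section States.
Variables (R : realType) (X : ptopologicalType).
Hypothesis X_compact : compact [set: X].

Definition state (L : (X -> R) -> R) : Prop :=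
  [/\ L (cst 1) = 1,
      forall f : X -> R, continuous f -> (forall x, 0 <= f x) -> 0 <= L f &
      forall a (f g : X -> R), continuous f -> continuous g ->
        L (fun x => a * f x + g x) = a * L f + L g].

(* The values at discontinuous functions are pinned to [0] so that the states
   form a compact subset of the product [X -> R] -> R. *)
Definition states : set ((X -> R) -> R) :=
  [set L | state L /\ forall f : X -> R, ~ continuous f -> L f = 0].

Section theory.
Variable L : (X -> R) -> R.
Hypothesis sL : state L.

Lemma state1 : L (cst 1) = 1. Proof. by case: sL. Qed.

Lemma state_ge0 (f : X -> R) : continuous f -> (forall x, 0 <= f x) -> 0 <= L f.
Proof. by case: sL => _ + _; exact. Qed.

Lemma state_linear a (f g : X -> R) : continuous f -> continuous g ->
  L (fun x => a * f x + g x) = a * L f + L g.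
Proof. by move=> cf cg; case: sL => _ _; apply. Qed.

Lemma cst_continuous_fun (c : R) : continuous (fun _ : X => c).
Proof. by move=> x; exact: cvg_cst. Qed.

Lemma state_zero : L (fun=> 0) = 0.
Proof.
have := state_linear (-1) (@cst_continuous_fun 0) (@cst_continuous_fun 0).
have -> : (fun _ : X => -1 * 0 + 0) = (fun=> 0 : R) by apply/funext => x; rewrite mulr0 addr0.
by rewrite mulN1r addNr.
Qed.

Lemma stateZ a (f : X -> R) : continuous f -> L (fun x => a * f x) = a * L f.
Proof.
move=> cf; have := state_linear a cf (@cst_continuous_fun 0).
rewrite state_zero addr0 => <-; congr L; apply/funext => x; by rewrite addr0.
Qed.

Lemma stateD (f g : X -> R) : continuous f -> continuous g ->
  L (fun x => f x + g x) = L f + L g.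
Proof.
move=> cf cg; have := state_linear 1 cf cg; rewrite mul1r => <-.
by congr L; apply/funext => x; rewrite mul1r.
Qed.

Lemma stateB (f g : X -> R) : continuous f -> continuous g ->
  L (fun x => f x - g x) = L f - L g.
Proof.
move=> cf cg; have := state_linear (-1) cg cf.
rewrite mulN1r addrC => <-; congr L; apply/funext => x.
by rewrite mulN1r addrC.
Qed.

Lemma state_cst c : L (fun=> c) = c.
Proof.
have := stateZ c (@cst_continuous_fun 1).
by rewrite state1 !mulr1.
Qed.

Lemma state_le (f g : X -> R) : continuous f -> continuous g -> (forall x, f x <= g x) -> L f <= L g.
Proof.
move=> cf cg fg; rewrite -subr_ge0 -stateB//; apply: state_ge0.
  by move=> x; apply: cvgB; [exact: cg|exact: cf].
by move=> x; rewrite subr_ge0.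
Qed.

Lemma state_dist (f g : X -> R) e : continuous f -> continuous g ->
  (forall x, `|f x - g x| <= e) -> `|L f - L g| <= e.
Proof.
move=> cf cg fg; rewrite -stateB//.
have cfg : continuous (fun x => f x - g x) by move=> x; apply: cvgB; [exact: cf|exact: cg].
have le := state_le cfg (@cst_continuous_fun e); have ge := state_le (@cst_continuous_fun (- e)) cfg.
rewrite !state_cst in le ge.
by rewrite ler_norml; apply/andP; split; [apply: ge|apply: le] => x;
  have := fg x; rewrite ler_norml => /andP[].
Qed.

Lemma state_sum (I : Type) (r : seq I) (a : I -> R) (f : I -> X -> R) :
  (forall i, continuous (f i)) ->
  continuous (fun x => \sum_(i <- r) a i * f i x) /\
  L (fun x => \sum_(i <- r) a i * f i x) = \sum_(i <- r) a i * L (f i).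
Proof.
move=> cf; elim: r => [|i r [IHc IHL]].
  under eq_fun do rewrite big_nil.
  by rewrite big_nil state_zero; split=> //; exact: cst_continuous_fun.
under eq_fun do rewrite big_cons.
rewrite big_cons state_linear// IHL; split=> //.
move=> x; apply: cvgD; last exact: IHc.
by apply: cvgM; [exact: cvg_cst|exact: cf].
Qed.

End theory.

Lemma bounded_continuous (f : X -> R) : continuous f -> exists M, forall x, `|f x| <= M.
Proof.
move=> cf; have nf : {within [set: X], continuous (fun x => `|f x|)}.
  by apply: continuous_subspaceT => x; apply: cvg_norm; exact: cf.
have [c _ cM] := compact_EVT_max (ex_intro _ point I : [set: X] !=set0) X_compact nf.
by exists `|f c| => x; apply: cM; rewrite inE.
Qed.

Lemma states_closed (E : topologicalType) (ev : E -> (X -> R) -> R) :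
  (forall f, continuous (ev ^~ f)) -> closed (ev @^-1` states).
Proof.
move=> cev.
have -> : ev @^-1` states = [set e | ev e (cst 1) = 1] `&`
   [set e | forall f : X -> R, continuous f -> (forall x, 0 <= f x) -> 0 <= ev e f] `&`
   [set e | forall a (f g : X -> R), continuous f -> continuous g ->
      ev e (fun x => a * f x + g x) = a * ev e f + ev e g] `&`
   [set e | forall f : X -> R, ~ continuous f -> ev e f = 0].
  by rewrite eqEsubset; split=> [e [[? ? ?] ?]|e [[[? ?] ?] ?]]; do ?split.
have ccst (c : R) : continuous (fun _ : E => c) by move=> e; exact: cvg_cst.
apply: closedI; first (apply: closedI; first apply: closedI).
- exact: closed_eq_fun.
- apply: closed_forall => f; apply: closed_imply => cf; apply: closed_imply => f0.
  exact: closed_ge0_fun.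
- apply: closed_forall => a; apply: closed_forall => f; apply: closed_forall => g.
  apply: closed_imply => cf; apply: closed_imply => cg; apply: closed_eq_fun => // e.
  apply: cvgD; last exact: cev.
  by apply: cvgM; [exact: cvg_cst|exact: cev].
- by apply: closed_forall => f; apply: closed_imply => nf; exact: closed_eq_fun.
Qed.

(** Banach-Alaoglu: [|L f|] is at most a bound of [|f|], so the states are closed in a product of
    segments. Only the continuity of the evaluations, compactness and surjectivity of [ev] are
    exported. *)
Lemma states_model : exists (E : topologicalType) (ev : E -> (X -> R) -> R),
  [/\ forall f, continuous (ev ^~ f), compact (ev @^-1` states) &
      forall L, exists e, ev e = L].
Proof.
pose E : topologicalType := prod_topology (fun _ : X -> R => R).
exists E, (fun (e : E) f => e f).
have cev (f : X -> R) : continuous (fun e : E => e f).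
  exact: (@pointwise_eval_continuous (X -> R) (fun _ : X -> R => R) f).
split=> // [|L]; last by exists L.
have /choice[M hM] : forall f : X -> R, exists M, continuous f -> forall x, `|f x| <= M.
  move=> f; have [cf|ncf] := pselect (continuous f); last by exists 0.
  by have [M hM] := bounded_continuous cf; exists M.
pose B (f : X -> R) : set R := `[- `|M f|, `|M f|]%classic.
have cB : compact [set L : E | forall f, B f (L f)].
  apply: (@tychonoff (X -> R : choiceType) (fun=> R)) => f; exact: segment_compact.
apply: (subclosed_compact (states_closed cev) cB) => L [sL L0] f; rewrite /B /= in_itv/=.
rewrite -ler_norml.
have [cf|ncf] := pselect (continuous f); last by rewrite L0// normr0.
have := state_dist sL cf (@cst_continuous_fun 0) (e := `|M f|).
rewrite state_zero// subr0; apply => x; rewrite subr0.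
exact: le_trans (hM f cf x) (ler_norm _).
Qed.

Lemma states_nonempty : states !=set0.
Proof.
exists (fun f => if `[< continuous f >] then f point else 0); split; last first.
  by move=> f ncf; case: asboolP.
split.
- by case: asboolP => // h; exfalso; apply: h; exact: cst_continuous_fun.
- by move=> f cf f0; case: asboolP.
- move=> a f g cf cg; case: asboolP => [_|h]; last first.
    exfalso; apply: h => x; apply: cvgD; last exact: cg.
    by apply: cvgM; [exact: cvg_cst|exact: cf].
  by case: asboolP => // _; case: asboolP.
Qed.

Lemma states_convex L L' l : 0 <= l <= 1 -> states L -> states L' ->
  states (fun f => (1 - l) * L f + l * L' f).
Proof.
move=> /andP[l0 l1] [sL L0] [sL' L0']; split; last first.
  by move=> f ncf; rewrite L0// L0'// !mulr0 addr0.
split.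
- by rewrite (state1 sL) (state1 sL'); ring.
- move=> f cf f0; apply: addr_ge0; apply: mulr_ge0; rewrite ?subr_ge0//.
    exact: (state_ge0 sL).
  exact: (state_ge0 sL').
- by move=> a f g cf cg; rewrite (state_linear sL)// (state_linear sL')//; ring.
Qed.

End States.

(** [K] is the image of [C] in the product of real lines indexed by [I]: points of [C] that no [r i]
    distinguishes are identified, and convergence is coordinatewise. *)
Lemma image_model (R : realType) (I : Type) (E : topologicalType) (C : set E)
    (r : I -> E -> R) : compact C -> (forall i, continuous (r i)) ->
  exists (K : topologicalType) (c : I -> K -> R),
  [/\ compact [set: K],
      forall (S : Type) (F : set_system S) (FF : Filter F) (g : S -> K) (k : K),
        (forall i, (fun s => c i (g s)) @ F --> c i k) -> g @ F --> k,
      (forall i, continuous (c i)) /\ (forall k k', (forall i, c i k = c i k') -> k = k'),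
      forall k, exists2 e, C e & forall i, c i k = r i e &
      forall e, C e -> exists k, forall i, c i k = r i e].
Proof.
move=> cC cr; pose P : topologicalType := prod_topology (fun _ : I => R).
pose f (e : E) : P := fun i => r i e.
pose K : topologicalType := set_type (f @` C).
exists K, (fun i (k : K) => (set_val k : P) i).
have cf : continuous f.
  by move=> e; apply: cvg_pointwise => i; exact: cr.
split.
- apply: set_type_compact; apply: continuous_compact => //.
  exact: continuous_subspaceT.
- by move=> S F FF g k h; apply: set_type_cvg; apply: cvg_pointwise.
- split=> [i|k k' kk']; last by apply: val_inj; apply/funext.
  move=> k; apply: (@continuous_comp K P R set_val (fun p : P => p i)).
    exact: set_val_continuous.
  exact: (@pointwise_eval_continuous I (fun=> R) i).
- by move=> k; have [e Ce eE] := set_valP k; exists e => // i; rewrite -[LHS]/(val k i) -eE.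
- move=> e Ce; have fC : f e \in f @` C by apply: mem_set; exists e.
  by exists (SigSub fC).
Qed.

(** * The induced action on the cube *)

Section CubeAction.
Variables (R : realType) (G : topologicalGroupType) (K : topologicalType).
Variables (c : nat * G -> K -> R) (M : nat -> R) (D : set G) (k0 : K).
Hypothesis K_compact : compact [set: K].
Hypothesis K_cvg : forall (S : Type) (F : set_system S) (FF : Filter F) (g : S -> K) (k : K),
  (forall p, (fun s => c p (g s)) @ F --> c p k) -> g @ F --> k.
Hypothesis c_continuous : forall p, continuous (c p).
Hypothesis c_inj : forall k k', (forall p, c p k = c p k') -> k = k'.
Hypothesis c_bound : forall p k, `|c p k| <= M p.1.
Hypothesis c_equicontinuous : forall i h (e : R), 0 < e ->
  \forall h' \near h, forall k, `|c (i, h') k - c (i, h) k| <= e.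
Hypothesis c_convex : forall k k' (l : R), 0 <= l <= 1 ->
  exists m, forall p, c p m = (1 - l) * c p k + l * c p k'.
Hypothesis c_translate : forall g k, exists k', forall i h, c (i, h) k' = c (i, (h * g)%g) k.
Hypotheses (D_countable : countable D) (D_dense : dense D).

Lemma dense_sequence : exists d : nat -> G, forall U, U !=set0 -> open U -> exists n, U (d n).
Proof.
have /pfcard_geP[D0|[f]] := D_countable.
  by have [|z []] := @D_dense setT _ openT; [exists 1%g|rewrite D0].
exists f => U U0 oU; have [z [Uz Dz]] := @D_dense U U0 oU.
by have [n _ fn] := @surj _ _ _ _ f z Dz; exists n; rewrite fn.
Qed.

(** [G] translates the first factor of K * Q * Q and fixes the other two; the action is transported
    to the cube, and [kappa] is the projection to [K]. *)
Lemma cube_action : exists (act : G -> cube R -> cube R) (kappa : cube R -> K),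
  [/\ continuous_action act, continuous kappa &
      forall g q i h, c (i, h) (kappa (act g q)) = c (i, (h * g)%g) (kappa q)].
Proof.
have [d dD] := dense_sequence.
(* Countably many coordinates suffice: by equicontinuity in [h], values along the dense sequence
   determine all others. The [1 +] keeps the denominator positive when the bound is 0. *)
pose x j k := c (code_row j, d (code_column j)) k / (1 + M (code_row j)).
have M0 i : 0 <= M i by apply: le_trans (c_bound (i, 1%g) k0).
have M1 i : 0 < 1 + M i by rewrite ltr_pwDl.
have cx j : continuous (x j).
  by move=> k; apply: cvgM; [exact: c_continuous|exact: cvg_cst].
have bx j k : `|x j k| <= 1.
  rewrite normrM normfV (gtr0_norm (M1 _)) ler_pdivrMr// mul1r.
  by apply: le_trans (c_bound _ _) _; rewrite /= lerDr.
have ix k k' : (forall j, x j k = x j k') -> k = k'.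
  move=> e; apply: c_inj => -[i h]; apply/eqP; rewrite -subr_eq0 -normr_le0 leNgt.
  apply/negP => d0; set del := `|_| in d0.
  have e3 : 0 < del / 3 by rewrite divr_gt0.
  have : nbhs h [set h' | forall k, `|c (i, h') k - c (i, h) k| <= del / 3].
    exact: c_equicontinuous.
  rewrite nbhsE => -[U [oU Uh] hU].
  have [n /hU hn] := dD U (ex_intro _ h Uh) oU.
  have en : c (i, d n) k = c (i, d n) k'.
    have := e (pair_code i n); rewrite /x code_rowK code_columnK => /mulIf; apply.
    by rewrite invr_neq0// gt_eqF.
  have h1 := hn k; have h2 := hn k'; rewrite -en in h2.
  have : del <= del / 3 + del / 3.
    rewrite {1}/del -(subrKA (c (i, d n) k)); apply: le_trans (ler_normD _ _) _.
    by apply: lerD => //; rewrite distrC.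
  by lra.
have vx k k' (l : R) : 0 <= l <= 1 -> exists m, forall j, x j m = (1 - l) * x j k + l * x j k'.
  move=> l01; have [m mE] := c_convex k k' l01; exists m => j.
  by rewrite /x mE; ring.
have [f [f' [cf cf' fK f'K]]] := stable_keller K_compact cx bx ix vx k0.
have [tr trE] : exists tr : G -> K -> K, forall g k i h, c (i, h) (tr g k) = c (i, (h * g)%g) k.
  have /choice[tr trE] : forall gk : G * K, exists k', forall i h,
    c (i, h) k' = c (i, (h * gk.1)%g) gk.2 by move=> [g k]; exact: c_translate.
  by exists (fun g k => tr (g, k)) => g k i h; rewrite trE.
(* Joint continuity splits into the continuity of one coordinate in [k] and equicontinuity, which
   handles the change of [g] uniformly in [k]. *)
have ctr : continuous (fun p : G * K => tr p.1 p.2).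
  move=> [g k]; apply: K_cvg => -[i h]; rewrite /= trE.
  under eq_fun do rewrite trE.
  apply/cvgrPdist_le => e e0.
  have e2 : 0 < e / 2 by rewrite divr_gt0.
  have /cvgrPdist_le/(_ _ e2) h1 := @c_continuous (i, (h * g)%g) k.
  have cm : (fun g' : G => (h * g')%g) @ g --> (h * g)%g.
    apply: (@continuous_comp _ _ _ (fun g' : G => (h, g')) (fun p : G * G => (p.1 * p.2)%g)).
      by apply: cvg_pair; [exact: cvg_cst|exact: cvg_id].
    exact: mulg_continuous.
  have h2 : \forall g' \near g, forall k', `|c (i, (h * g')%g) k' - c (i, (h * g)%g) k'| <= e / 2.
    exact: cm (c_equicontinuous i (h * g)%g e2).
  exists ([set g' | forall k', `|c (i, (h * g')%g) k' - c (i, (h * g)%g) k'| <= e / 2],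
          [set k' | `|c (i, (h * g)%g) k - c (i, (h * g)%g) k'| <= e / 2]); first by split.
  move=> [g' k'] /= [a b]; rewrite -(subrKA (c (i, (h * g)%g) k')).
  apply: le_trans (ler_normD _ _) _; rewrite (splitr e); apply: lerD => //.
  by rewrite distrC.
pose act g q := let p := f' q in f ((tr g p.1.1, p.1.2), p.2).
exists act, (fun q => (f' q).1.1); split.
- split.
  + move=> q; rewrite /act (_ : tr _ _ = (f' q).1.1) -?surjective_pairing//.
    by apply: c_inj => -[i h]; rewrite trE mulg1.
  + move=> g h q; rewrite /act fK /=; congr (f ((_, _), _)).
    by apply: c_inj => -[i h']; rewrite !trE mulgA.
  + move=> z.
    have c2 : (fun z' : G * cube R => f' z'.2) @ z --> f' z.2.
      by apply: (@continuous_comp _ _ _ snd f'); [exact: cvg_snd|exact: cf'].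
    have c21 : (fun z' : G * cube R => (f' z'.2).1) @ z --> (f' z.2).1.
      exact: (cvg_comp _ _ c2 cvg_fst).
    have c22 : (fun z' : G * cube R => (f' z'.2).2) @ z --> (f' z.2).2.
      exact: (cvg_comp _ _ c2 cvg_snd).
    have c211 : (fun z' : G * cube R => (f' z'.2).1.1) @ z --> (f' z.2).1.1.
      exact: (cvg_comp _ _ c21 cvg_fst).
    have c212 : (fun z' : G * cube R => (f' z'.2).1.2) @ z --> (f' z.2).1.2.
      exact: (cvg_comp _ _ c21 cvg_snd).
    have cg : (fun z' : G * cube R => z'.1) @ z --> z.1 by exact: cvg_fst.
    have ct : (fun z' : G * cube R => tr z'.1 (f' z'.2).1.1) @ z --> tr z.1 (f' z.2).1.1.
      exact: (cvg_comp _ _ (cvg_pair cg c211) (ctr (z.1, (f' z.2).1.1))).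
    exact: (cvg_comp _ _ (cvg_pair (cvg_pair ct c212) c22)
      (cf ((tr z.1 (f' z.2).1.1, (f' z.2).1.2), (f' z.2).2))).
- move=> q; apply: (@continuous_comp _ _ _ (fun q => (f' q).1) fst); last exact: cvg_fst.
  by apply: (@continuous_comp _ _ _ f' fst); [exact: cf'|exact: cvg_fst].
- by move=> g q i h; rewrite /act fK /= trE.
Qed.

End CubeAction.

(** * Integration against a Borel probability measure *)

Section IntegralState.
Variables (R : realType) (X : ptopologicalType).
Hypothesis X_compact : compact [set: X].
Variable mu : probability (borel X) R.

Definition mean (F : X -> R) : R := \int[mu]_(x in [set: borel X]) F x.

Lemma borel_measurable_fun (F : X -> R) : continuous F ->
  measurable_fun [set: borel X] (F : borel X -> R).
Proof.
move=> cF; apply: (measurability _ (RGenOInfty.measurableE R)).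
move=> /= _ [_ [r ->] <-]; rewrite setTI; apply: sub_sigma_algebra.
have /continuousP : continuous F by [].
by apply; exact: rray_open.
Qed.

Lemma borel_integrable (F : X -> R) : continuous F ->
  mu.-integrable [set: borel X] (EFin \o (F : borel X -> R)).
Proof.
move=> cF; apply: measurable_bounded_integrable => //.
- by apply: le_lt_trans (probability_le1 mu measurableT) _; rewrite ltry.
- exact: borel_measurable_fun.
- have [M hM] := bounded_continuous X_compact cF.
  exists M; split; rewrite ?num_real// => r Mr x _ /=.
  by apply: le_trans (hM x) _; exact: ltW.
Qed.

Lemma mean_state : state mean.
Proof.
split.
- transitivity (1 * fine (mu setT)); first exact: Rintegral_cst.
  by rewrite mul1r; have -> : mu setT = 1%E by exact: probability_setT.
- by move=> F cF F0; apply: Rintegral_ge0.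
- move=> a f g cf cg; rewrite /mean RintegralD//.
  + by rewrite RintegralZl//; exact: borel_integrable.
  + apply: borel_integrable => x; apply: cvgM; [exact: cvg_cst|exact: cf].
  + exact: borel_integrable.
Qed.

Lemma mean_invariant (G : topologicalGroupType) (act : G -> X -> X) g (F : X -> R) :
  continuous_action act -> invariant_measure act mu -> continuous F ->
  mean (fun x => F (act g x)) = mean F.
Proof.
move=> [act1 actM cact] inv cF.
have ca h : continuous (act h).
  move=> x; apply: (@continuous_comp _ _ _ (fun x => (h, x)) (fun p : G * X => act p.1 p.2)).
    by apply: cvg_pair; [exact: cvg_cst|exact: cvg_id].
  exact: cact.
have ma : measurable_fun [set: borel X] (act g : borel X -> borel X).
  apply: (measurability _ (erefl : @measurable _ (borel X) = <<s open >>)).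
  move=> /= _ [U oU <-]; rewrite setTI; apply: sub_sigma_algebra.
  by have /continuousP := ca g; apply.
congr fine.
transitivity (\int[pushforward mu (act g : borel X -> borel X)]_(x in [set: borel X]) (F x)%:E)%E.
  rewrite integral_pushforward ?preimage_setT//.
  - by apply/measurable_EFinP; exact: borel_measurable_fun.
  - apply: (@borel_integrable (F \o act g)) => x.
    by apply: continuous_comp; [exact: ca|exact: cF].
apply: eq_measure_integral => A mA _; rewrite /= /pushforward.
have -> : act g @^-1` A = act g^-1%g @` A.
  rewrite eqEsubset; split => x.
    by move=> Ax; exists (act g x) => //; rewrite -actM mulVg act1.
  by move=> [z Az <-]; rewrite /= -actM mulgV act1.
exact: inv.
Qed.

End IntegralState.

(** * Nearest points for a finite sum of squares *)

Section SumOfSquares.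
Variables (R : realType) (I : eqType) (s : seq I).

Lemma variational_inequality (b e : I -> R) :
  (forall l, 0 < l <= 1 ->
     \sum_(p <- s) b p ^+ 2 <= \sum_(p <- s) (b p + l * e p) ^+ 2) ->
  0 <= \sum_(p <- s) b p * e p.
Proof.
move=> h; set B := \sum_(p <- s) _; rewrite leNgt; apply/negP => B0.
pose Ee := \sum_(p <- s) e p ^+ 2.
have E0 : 0 <= Ee by apply: sumr_ge0 => p _; exact: sqr_ge0.
(* If [B < 0], this step lies in (0, 1] and satisfies [l * Ee <= - B], so the change
   [l * (2 * B + l * Ee)] is negative. *)
pose l := - B / (Ee - B + 1).
have d0 : 0 < Ee - B + 1 by lra.
have l0 : 0 < l by rewrite divr_gt0// oppr_gt0.
have l1 : l <= 1 by rewrite ler_pdivrMr// mul1r; lra.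
have lE : l * Ee <= - B.
  rewrite /l mulrAC ler_pdivrMr//; nra.
have := h l; rewrite l0 l1 => /(_ isT).
have -> : \sum_(p <- s) (b p + l * e p) ^+ 2 =
    \sum_(p <- s) b p ^+ 2 + l * (2 * B + l * Ee).
  have -> : l * (2 * B + l * Ee) =
      \sum_(p <- s) (l * (2 * (b p * e p)) + l * (l * e p ^+ 2)).
    by rewrite big_split /= -!mulr_sumr mulrDr.
  by rewrite -big_split /=; apply: eq_bigr => p _; ring.
rewrite lerDl pmulr_rge0//; lra.
Qed.

Lemma sum_sqr_eq0 (b : I -> R) : \sum_(p <- s) b p ^+ 2 <= 0 ->
  forall p, p \in s -> b p = 0.
Proof.
move=> h p ps; apply/eqP; rewrite -sqrf_eq0 eq_le sqr_ge0 andbT.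
apply: le_trans h; rewrite (big_rem _ ps)/= lerDl.
by apply: sumr_ge0 => q _; exact: sqr_ge0.
Qed.

End SumOfSquares.

Lemma continuous_sub_cst (R : realType) (T : topologicalType) (f : T -> R) (a : R) :
  continuous f -> continuous (fun x => f x - a).
Proof. by move=> cf x; apply: cvgB; [exact: cf|exact: cvg_cst]. Qed.

(** * Invariant states *)

Section InvariantState.
Variables (R : realType) (G : topologicalGroupType) (X : ptopologicalType).
Variables (act : G -> X -> X) (D : set G).
Hypothesis X_compact : compact [set: X].
Hypothesis act_continuous : continuous_action act.
Hypotheses (D_countable : countable D) (D_dense : dense D).
Hypothesis cube_invariant : forall a : G -> cube R -> cube R, continuous_action a ->
  exists mu : probability (borel (cube R)) R, invariant_measure a mu.

Lemma act_continuousr g : continuous (act g).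
Proof.
case: act_continuous => _ _ ca x.
apply: (@continuous_comp _ _ _ (fun x => (g, x)) (fun p : G * X => act p.1 p.2)); last exact: ca.
by apply: cvg_pair; [exact: cvg_cst|exact: cvg_id].
Qed.

Lemma comp_act_continuous (f : X -> R) g : continuous f -> continuous (fun x => f (act g x)).
Proof. by move=> cf x; apply: continuous_comp; [exact: act_continuousr|exact: cf]. Qed.

(** Joint continuity gives the estimate near each [(h, x)]; compactness of [X] makes it uniform in
    [x]. *)
Lemma act_equicontinuous (f : X -> R) h (e : R) : continuous f -> 0 < e ->
  \forall h' \near h, forall x, `|f (act h' x) - f (act h x)| <= e.
Proof.
move=> cf e0; case: act_continuous => _ _ ca.
have /compact_near_coveringP cov := X_compact.
have : \forall h' \near h, [set: X] `<=` [set x | `|f (act h' x) - f (act h x)| <= e].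
  apply: (cov G (nbhs h) (fun h' x => `|f (act h' x) - f (act h x)| <= e)) => x _.
  have cF : (fun p : G * X => f (act p.1 p.2)) @ (h, x) --> f (act h x).
    exact: (cvg_comp _ _ (ca (h, x)) (cf (act h x))).
  have e2 : 0 < e / 2 by rewrite divr_gt0.
  move/cvgrPdist_le : cF => /(_ _ e2) [[U V] [/= Uh Vx] UV].
  exists (V, U); first by split.
  move=> [x' h'] /= [Vx' Uh'].
  have h1 := UV (h', x') (conj Uh' Vx').
  have h2 := UV (h, x') (conj (nbhs_singleton Uh) Vx').
  rewrite /= in h1 h2; rewrite -(subrKA (f (act h x))).
  apply: le_trans (ler_normD _ _) _; rewrite (splitr e); apply: lerD => //.
  by rewrite distrC.
by apply: filterS => h' hh x; exact: hh.
Qed.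

Lemma state_translate (L : (X -> R) -> R) g : states L -> states (fun f => L (fun x => f (act g x))).
Proof.
case: act_continuous => act1 actM _ [sL L0]; split; last first.
  (* Translation by [g] is undone by its inverse, so it keeps a discontinuous [f] discontinuous and
     the pinned value 0 is respected. *)
  move=> f ncf; apply: L0 => cf; apply: ncf => x.
  have -> : f = (fun x => f (act g (act g^-1%g x))).
    by apply/funext => z; rewrite -actM mulgV act1.
  by apply: (@continuous_comp _ _ _ (act g^-1%g) (fun x => f (act g x)));
    [exact: act_continuousr|exact: cf].
split.
- exact: (state1 sL).
- move=> f cf f0; apply: (state_ge0 sL) => [|x]; [exact: comp_act_continuous|exact: f0].
- by move=> a f g' cf cg; apply: (state_linear sL); exact: comp_act_continuous.
Qed.

Lemma finite_invariant_state (phi : nat -> X -> R) (s : seq (nat * G)) :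
  (forall i, continuous (phi i)) ->
  exists2 L : (X -> R) -> R, states L &
    forall p, p \in s -> L (fun x => phi p.1 (act p.2 x)) = L (phi p.1).
Proof.
move=> cphi; have [E [ev [cev cS sur]]] := states_model R X_compact.
pose r (p : nat * G) e := ev e (fun x => phi p.1 (act p.2 x)).
have cr p : continuous (r p) by exact: cev.
have ca p : continuous (fun x => phi p.1 (act p.2 x)) by exact: comp_act_continuous.
have [K [c [cK Kcvg [cc ic] Kr rK]]] := image_model cS cr.
have /choice[M hM] : forall i, exists M, forall x, `|phi i x| <= M.
  by move=> i; exact: bounded_continuous.
have [e0 Ce0] : exists e, (ev @^-1` @states R X) e.
  by have [L sL] := states_nonempty R X; have [e eL] := sur L; exists e; rewrite /preimage /= eL.
have [k0 _] := rK _ Ce0.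
have cst0 : continuous (fun _ : X => 0 : R) by move=> x; exact: cvg_cst.
have bound p k : `|c p k| <= M p.1.
  have [e [se _] ->] := Kr k; rewrite /r -[X in `|X|]subr0 -(state_zero se).
  by apply: (state_dist se) => // x; rewrite subr0; exact: hM.
have equi i h (eps : R) : 0 < eps ->
    \forall h' \near h, forall k, `|c (i, h') k - c (i, h) k| <= eps.
  move=> eps0; have := act_equicontinuous h (cphi i) eps0.
  apply: filterS => h' hh k; have [e [se _] ek] := Kr k; rewrite !ek /r.
  exact: (state_dist se (ca (i, h')) (ca (i, h))).
have conv k k' (l : R) : 0 <= l <= 1 ->
    exists m, forall p, c p m = (1 - l) * c p k + l * c p k'.
  move=> l01; have [e Ce ek] := Kr k; have [e' Ce' ek'] := Kr k'.
  have [e2 e2E] := sur (fun f => (1 - l) * ev e f + l * ev e' f).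
  have [|m mE] := rK e2; first by rewrite /preimage /= e2E; exact: states_convex.
  by exists m => p; rewrite mE ek ek' /r e2E.
have trans g k : exists k', forall i h, c (i, h) k' = c (i, (h * g)%g) k.
  have [e Ce ek] := Kr k; have [e2 e2E] := sur (fun f => ev e (fun x => f (act g x))).
  have [|m mE] := rK e2; first by rewrite /preimage /= e2E; exact: state_translate.
  exists m => i h; rewrite mE ek /r e2E /=; congr (ev e); apply/funext => x.
  by case: act_continuous => _ actM _; rewrite actM.
have [a [kap [ca' ckap kapE]]] :=
  cube_action k0 cK Kcvg cc ic bound equi conv trans D_countable D_dense.
have [mu inv] := cube_invariant ca'.
have cQ := @cube_compact R.
have sT := mean_state cQ mu.
pose I p := mean mu (fun q => c p (kap q)).
have cck p : continuous (fun q => c p (kap q)).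
  by move=> q; apply: (@continuous_comp _ _ _ kap (c p)); [exact: ckap|exact: cc].
(* The value of [kap q] at [(i, h)] is that of [kap (a h q)] at [(i, 1)], so invariance of [mu]
   removes [h]. *)
have Iinv i h : I (i, h) = I (i, 1%g).
  rewrite /I -(mean_invariant cQ h ca' inv (cck (i, 1%g))).
  by congr mean; apply/funext => q; rewrite kapE mul1g.
(* Adjoining the pairs [(i, 1)] lets one state match the means both of the translates and of the
   functions themselves. *)
suff [e Ce eI] : exists2 e, (ev @^-1` @states R X) e &
    forall p, p \in s ++ [seq (p.1, 1%g) | p <- s] -> r p e = I p.
  exists (ev e) => // -[i h] ps.
  have -> : ev e (phi (i, h).1) = r (i, 1%g) e.
    rewrite /r; congr (ev e); apply/funext => x /=.
    by case: act_continuous => act1 _ _; rewrite act1.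
  rewrite -[LHS]/(r (i, h) e) !eI ?Iinv// mem_cat ?ps//.
  by apply/orP; right; apply/mapP; exists (i, h).
move: (s ++ _) => s'.
(* The point of [K] nearest to the mean [I] is [I] itself: integrate the
   variational inequality of the projection. *)
pose dist e := \sum_(p <- s') (r p e - I p) ^+ 2.
have cdist : continuous dist.
  rewrite /dist; elim: (s') => [|p s2 IH] e.
    by under eq_fun do rewrite big_nil; exact: cvg_cst.
  under eq_fun do rewrite big_cons expr2.
  apply: cvgD; last exact: IH.
  by apply: cvgM; (apply: cvgB; [exact: cr|exact: cvg_cst]).
have [e /set_mem Ce emin] := compact_EVT_min (ex_intro _ e0 Ce0) cS (continuous_subspaceT cdist).
exists e => //.
have var e' : (ev @^-1` @states R X) e' ->
    0 <= \sum_(p <- s') (r p e - I p) * (r p e' - r p e).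
  move=> Ce'; apply: variational_inequality => l /andP[l0 l1].
  have [e2 e2E] := sur (fun f => (1 - l) * ev e f + l * ev e' f).
  have Ce2 : (ev @^-1` @states R X) e2.
    by rewrite /preimage /= e2E; apply: states_convex => //; rewrite ltW.
  apply: le_trans (emin e2 (mem_set Ce2)) _; rewrite le_eqVlt; apply/orP; left; apply/eqP.
  apply: eq_bigr => p _; congr (_ ^+ 2).
  by rewrite /r e2E /=; ring.
have ge q : 0 <= \sum_(p <- s') (r p e - I p) * (c p (kap q) - r p e).
  have [e' Ce' eE] := Kr (kap q).
  by under eq_bigr do rewrite eE; exact: var.
pose b p := r p e - I p.
have cckr p : continuous (fun q => c p (kap q) - r p e).
  exact: continuous_sub_cst.
have [cs ms] := state_sum sT s' b cckr.
(* Under the integral the second factor becomes [I p - r p e], that is [- b p]: minus a sum of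
   squares is nonnegative. *)
have := state_ge0 sT cs ge; rewrite ms => h.
have eqs p : p \in s' -> b p = 0.
  apply: sum_sqr_eq0; rewrite -oppr_ge0; apply: le_trans h _.
  rewrite le_eqVlt; apply/orP; left; apply/eqP.
  rewrite -sumrN; apply: eq_bigr => p' _.
  rewrite (stateB sT (@cck p'))//; last exact: cst_continuous_fun.
  by rewrite (state_cst sT) -/(I p') /b expr2; ring.
by move=> p ps; apply/eqP; rewrite -subr_eq0; apply/eqP; exact: eqs.
Qed.

Theorem invariant_state : exists2 L : (X -> R) -> R, states L &
  forall (f : X -> R) g, continuous f -> L (fun x => f (act g x)) = L f.
Proof.
have [E [ev [cev cS sur]]] := states_model R X_compact.
pose C := ev @^-1` @states R X.
pose Z (i : (X -> R) * G) : set E :=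
  [set e | continuous i.1 -> ev e (fun x => i.1 (act i.2 x)) = ev e i.1].
have cZ i : closed (Z i).
  by apply: closed_imply => ci; apply: closed_eq_fun; exact: cev.
have fin : finI [set: (X -> R) * G] (fun i => C `&` Z i).
  move=> D' _; pose l := enum_fset D'.
  (* For discontinuous functions the condition [Z] is vacuous, so they may be replaced by 0, as may
     the indices beyond the list. *)
  pose phi n : X -> R := let f := (nth ((fun=> 0), 1%g) l n).1 in
    if `[< continuous f >] then f else (fun=> 0).
  have cphi n : continuous (phi n).
    rewrite /phi; case: asboolP => // _ x; exact: cvg_cst.
  pose s := [seq (n, (nth ((fun=> 0 : R), 1%g) l n).2) | n <- iota 0 (size l)].
  have [L sL hL] := finite_invariant_state s cphi.
  have [e eL] := sur L; exists e => i /= iD; split; first by rewrite /C /preimage /= eL.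
  move=> ci; have il : i \in l by [].
  have := hL (index i l, i.2).
  rewrite eL /= /phi nth_index//; case: asboolP => // _; apply.
  apply/mapP; exists (index i l); last by rewrite nth_index.
  by rewrite mem_iota add0n index_mem.
have PF := finI_filter fin.
have [|e [Ce cl]] := cS _ PF.
  exists (C `&` Z ((fun=> 0), 1%g)); last by move=> e [].
  exact: finI_from1.
exists (ev e) => // f g cf.
have : closure (C `&` Z (f, g)) e.
  move=> U nU; apply: cl => //.
  by exists (C `&` Z (f, g)) => //; exact: (@finI_from1 _ _ setT (fun i => C `&` Z i) (f, g)).
move=> /(closureS (@subIsetr _ C _)).
by rewrite -(closure_id _).1//; apply.
Qed.

End InvariantState.

(** * From states to regular measures *)

Section Riesz.
Variables (R : realType) (X : ptopologicalType).
Hypotheses (X_compact : compact [set: X]) (X_hausdorff : hausdorff_space X).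
Variable L : (X -> R) -> R.
Hypothesis sL : state L.

(** Vanishing outside [U] replaces having support in [U]; where a closed set inside [U] is required,
    [cut] supplies it at a cost of at most [e] under [L]. *)
Definition subordinate (U : set X) (f : X -> R) : Prop :=
  [/\ continuous f, forall x, 0 <= f x <= 1 & forall x, ~ U x -> f x = 0].

Definition inner_content (U : set X) : R := sup [set L f | f in subordinate U].

Lemma subordinate0 U : subordinate U (fun=> 0).
Proof. by split=> // [|x]; [exact: cst_continuous_fun|rewrite lexx ler01]. Qed.

Lemma subordinate_state_bounds U f : subordinate U f -> 0 <= L f <= 1.
Proof.
move=> [cf f01 _]; rewrite (state_ge0 sL)//=; last by move=> x; have /andP[] := f01 x.
rewrite -[leRHS](state_cst sL); apply: (state_le sL) => //.
- exact: cst_continuous_fun.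
- by move=> x; have /andP[] := f01 x.
Qed.

Lemma inner_content_ge U f : subordinate U f -> L f <= inner_content U.
Proof.
move=> Uf; apply: ub_le_sup; last by exists f.
by exists 1 => _ [g Ug <-]; have /andP[] := subordinate_state_bounds Ug.
Qed.

Lemma inner_content_le U c : (forall f, subordinate U f -> L f <= c) -> inner_content U <= c.
Proof.
move=> h; apply: ge_sup; last by move=> _ [f Uf <-]; exact: h.
by exists (L (fun=> 0)), (fun=> 0) => //; exact: subordinate0.
Qed.

Lemma inner_content_bounds U : 0 <= inner_content U <= 1.
Proof.
apply/andP; split.
  by rewrite -(state_zero sL); apply: inner_content_ge; exact: subordinate0.
by apply: inner_content_le => f /subordinate_state_bounds/andP[].
Qed.

Lemma inner_content_mono U V : U `<=` V -> inner_content U <= inner_content V.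
Proof.
move=> UV; apply: inner_content_le => f [cf f01 f0]; apply: inner_content_ge.
by split=> // x Vx; apply: f0 => /UV.
Qed.

Lemma inner_content0 : inner_content set0 = 0.
Proof.
apply/eqP; rewrite eq_le; have /andP[-> _] := inner_content_bounds set0; rewrite andbT.
apply: inner_content_le => f [_ _ f0]; rewrite (_ : f = fun=> 0) ?(state_zero sL)//.
by apply/funext => x; exact: f0.
Qed.

Lemma inner_contentT : inner_content setT = 1.
Proof.
apply/eqP; rewrite eq_le; have /andP[_ ->] /= := inner_content_bounds setT.
rewrite -(state_cst sL 1); apply: inner_content_ge; split=> [|x|x []//].
  exact: cst_continuous_fun.
by rewrite ler01 lexx.
Qed.

Definition cut (e : R) (f : X -> R) x := Num.max 0 (f x - e).

Lemma cut_continuous e f : continuous f -> continuous (cut e f).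
Proof.
move=> cf x; apply: (@cvg_maxr _ _ _ _ (cst 0) (fun x => f x - e)); first exact: cvg_cst.
by apply: cvgB; [exact: cf|exact: cvg_cst].
Qed.

Lemma state_cut e f : continuous f -> L f - e <= L (cut e f).
Proof.
move=> cf; have ce := @cst_continuous_fun R X e.
rewrite -[X in _ - X](state_cst sL) -(stateB sL)//; apply: (state_le sL).
- by move=> x; apply: cvgB; [exact: cf|exact: ce].
- exact: cut_continuous.
- by move=> x; rewrite /cut le_max lexx orbT.
Qed.

Lemma closed_superlevel e (f : X -> R) : continuous f -> closed [set x | e <= f x].
Proof. by move=> /continuous_closedP cf; apply: (cf [set r | e <= r]); exact: closed_ge. Qed.

Lemma urysohn_function (A U : set X) : closed A -> open U -> A `<=` U ->
  exists2 f, subordinate U f & forall x, A x -> f x = 1.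
Proof.
move=> cA oU AU.
have nX := compact_normal X_hausdorff X_compact.
have UA0 : ~` U `&` A = set0 by rewrite -subset0 => x [Ux /AU].
have /(@uniform_separatorP _ R)[f [cf f01 f0 f1]] :=
  normal_uniform_separator nX (open_closedC oU) cA UA0.
exists f; last by move=> x Ax; apply: f1; exists x.
split=> // x; last by move=> Ux; apply: f0; exists x.
by have := f01 (f x) (ex_intro2 _ _ x I erefl); rewrite /= in_itv.
Qed.

(** Take [u] equal to 1 on the part of [C] missed by the first [N] sets. Where [u > 1/2], the
    truncation of [2 * u] is already 1; the rest of [C] lies in a closed set covered by the first
    [N] sets, left to the induction. *)
Lemma subordinate_cover (U : nat -> set X) N (C : set X) :
  (forall i, open (U i)) -> closed C -> C `<=` \bigcup_(i < N) U i ->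
  exists psi : nat -> X -> R, (forall i, subordinate (U i) (psi i)) /\
    forall x, C x -> 1 <= \sum_(i < N) psi i x.
Proof.
move=> oU; elim: N C => [|N IH] C cC CU.
  exists (fun _ _ => 0); split=> [i|x /CU [i]//]; exact: subordinate0.
pose W := \bigcup_(i < N) U i.
have oW : open W by apply: bigcup_open => i _; exact: oU.
have [||x [Cx Wx]|u [cu u01 u0] u1] := @urysohn_function (C `\` W) (U N).
- by rewrite setDE; apply: closedI => //; exact: open_closedC.
- exact: oU.
- have [i /= iN Ui] := CU x Cx; move: iN; rewrite ltnS leq_eqVlt => /predU1P[<-//|iN].
  by exfalso; apply: Wx; exists i.
pose C' := C `&` [set x | u x <= 2^-1].
have cC' : closed C'.
  apply: closedI => //; have -> : [set x | u x <= 2^-1] = [set x | - 2^-1 <= - u x].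
    by rewrite eqEsubset; split=> x /=; rewrite lerN2.
  by apply: closed_superlevel => x; apply: cvgN; exact: cu.
have C'W : C' `<=` W.
  move=> x [Cx /= ux]; apply: contrapT => Wx; move: ux; rewrite u1//.
  by lra.
have [psi [psiU psi1]] := IH C' cC' C'W.
exists (fun i => if i == N then (fun x => Num.min 1 (2 * u x)) else psi i); split.
  move=> i; case: eqP => [->|_]; last exact: psiU.
  split=> [x|x|x Ux].
  - apply: (@cvg_minr _ _ _ _ (cst 1) (fun x => 2 * u x)); first exact: cvg_cst.
    by apply: cvgM; [exact: cvg_cst|exact: cu].
  - by have /andP[? ?] := u01 x; rewrite le_min ler01 mulr_ge0//= ge_min lexx.
  - by rewrite u0// mulr0 min_r// ler01.
move=> x Cx; rewrite big_ord_recr /= eqxx.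
have -> : \sum_(i < N) (if nat_of_ord i == N then (fun x => Num.min 1 (2 * u x)) else psi i) x =
   \sum_(i < N) psi i x by apply: eq_bigr => i _; rewrite ltn_eqF.
have s0 : 0 <= \sum_(i < N) psi i x.
  by apply: sumr_ge0 => i _; have [_ /(_ x)/andP[]] := psiU i.
have [ux|ux] := leP (u x) 2^-1.
  have := psi1 x (conj Cx ux) => h; apply: le_trans h _; rewrite lerDl.
  by have /andP[? ?] := u01 x; rewrite le_min ler01 mulr_ge0.
have -> : Num.min 1 (2 * u x) = 1 by apply: min_l; lra.
by rewrite lerDr.
Qed.

Lemma compact_finite_cover (U : nat -> set X) (C : set X) :
  (forall i, open (U i)) -> closed C -> C `<=` \bigcup_i U i ->
  exists N, C `<=` \bigcup_(i < N) U i.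
Proof.
move=> oU cC CU.
have /compact_near_coveringP cov : compact C by apply: (subclosed_compact cC X_compact).
have [N _ hN] : \forall n \near \oo, C `<=` [set x | (\bigcup_(i < n) U i) x].
  apply: (cov nat \oo (fun n x => (\bigcup_(i < n) U i) x)) => x /CU[i _ Ui].
  exists (U i, [set n | (i < n)%N]).
    by split=> /=; [apply: open_nbhs_nbhs|exists i.+1].
  by move=> [y n] /= [Uy ni]; exists i.
by exists N; apply: hN => /=.
Qed.

Lemma inner_content_finite_cover (U : nat -> set X) f e : (forall i, open (U i)) ->
  subordinate (\bigcup_i U i) f -> 0 < e ->
  exists N, L f - e <= \sum_(i < N) inner_content (U i).
Proof.
move=> oU [cf f01 f0] e0.
have cC := closed_superlevel (e := e) cf.
have [|N CN] := compact_finite_cover oU cC.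
  move=> x /= ex; apply: contrapT => Ux; move: ex; rewrite f0//.
  by rewrite leNgt e0.
have [psi [psiU psi1]] := subordinate_cover oU cC CN.
exists N; apply: le_trans (state_cut e cf) _.
have cpsi i : continuous (psi i) by case: (psiU i).
have [cs sE] := state_sum sL (index_enum 'I_N) (fun=> 1) (fun i : 'I_N => cpsi i).
apply: (@le_trans _ _ (\sum_(i < N) 1 * L (psi i))); last first.
  by apply: ler_sum => i _; rewrite mul1r; exact: inner_content_ge.
rewrite -sE; apply: (state_le sL) => //; first exact: cut_continuous.
move=> x; under eq_bigr do rewrite mul1r.
have s0 : 0 <= \sum_(i < N) psi i x.
  by apply: sumr_ge0 => i _; have [_ /(_ x)/andP[]] := psiU i.
rewrite /cut ge_max s0/=.
have [ex|ex] := leP e (f x); last by apply: le_trans s0; lra.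
by apply: le_trans (psi1 x ex); have /andP[? ?] := f01 x; lra.
Qed.

Definition outer_content (A : set X) : R :=
  inf [set inner_content U | U in [set U | open U /\ A `<=` U]].

Lemma outer_content_le A U : open U -> A `<=` U -> outer_content A <= inner_content U.
Proof.
move=> oU AU; apply: ge_inf; last by exists U.
by exists 0 => _ [V _ <-]; have /andP[] := inner_content_bounds V.
Qed.

Lemma outer_content_ge A c :
  (forall U, open U -> A `<=` U -> c <= inner_content U) -> c <= outer_content A.
Proof.
move=> h; apply: lb_le_inf.
  by exists (inner_content setT), setT => //; split => //; exact: openT.
by move=> _ [U [oU AU] <-]; exact: h.
Qed.

Lemma outer_content_open U : open U -> outer_content U = inner_content U.
Proof.
move=> oU; apply/eqP; rewrite eq_le outer_content_le//=.
by apply: outer_content_ge => V oV; exact: inner_content_mono.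
Qed.

Lemma outer_content_ge0 A : 0 <= outer_content A.
Proof. by apply: outer_content_ge => U _ _; have /andP[] := inner_content_bounds U. Qed.

Lemma outer_content_mono A B : A `<=` B -> outer_content A <= outer_content B.
Proof.
move=> AB; apply: outer_content_ge => U oU BU; apply: outer_content_le => //.
exact: subset_trans BU.
Qed.

Lemma outer_content_adherent A e : 0 < e ->
  exists U, [/\ open U, A `<=` U & inner_content U <= outer_content A + e].
Proof.
move=> e0; apply: contrapT => h.
have : outer_content A + e <= outer_content A.
  apply: outer_content_ge => U oU AU; rewrite leNgt; apply/negP => lt.
  by apply: h; exists U; split => //; exact: ltW.
by rewrite gerDl leNgt e0.
Qed.

Definition riesz_outer (A : set X) : \bar R := (outer_content A)%:E.

Lemma riesz_outer0 : riesz_outer set0 = 0%E.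
Proof. by rewrite /riesz_outer outer_content_open ?inner_content0//; exact: open0. Qed.

Lemma riesz_outer_ge0 A : (0 <= riesz_outer A)%E.
Proof. by rewrite lee_fin outer_content_ge0. Qed.

Lemma riesz_outer_mono : {homo riesz_outer : A B / A `<=` B >-> (A <= B)%E}.
Proof. by move=> A B AB; rewrite lee_fin; exact: outer_content_mono. Qed.

Lemma inner_content_sigma_subadditive (U : nat -> set X) : (forall i, open (U i)) ->
  ((inner_content (\bigcup_i U i))%:E <= \sum_(i <oo) (inner_content (U i))%:E)%E.
Proof.
move=> oU; have ge0 n : (0 <= (inner_content (U n))%:E)%E.
  by rewrite lee_fin; have /andP[] := inner_content_bounds (U n).
have s0 : (0 <= \sum_(i <oo) (inner_content (U i))%:E)%E by apply: nneseries_ge0.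
case sE : (\sum_(i <oo) (inner_content (U i))%:E)%E s0 => [s| |]; rewrite ?leey// => _.
rewrite lee_fin; apply: inner_content_le => f Uf; apply/ler_addgt0Pr => e e0.
have [N hN] := inner_content_finite_cover oU Uf e0.
rewrite -lerBlDr; apply: le_trans hN _; rewrite -lee_fin -sE -sumEFin.
have := @nneseries_lim_ge R (fun i => (inner_content (U i))%:E) xpredT 0%N N.
by rewrite big_mkord; apply.
Qed.

Lemma riesz_outer_sigma_subadditive : sigma_subadditive riesz_outer.
Proof.
move=> F; apply/lee_addgt0Pr => e e0.
have pe i : 0 < e / (2 ^ i.+1)%:R by rewrite divr_gt0// ltr0n expn_gt0.
have /choice[U hU] : forall i, exists U, [/\ open U, F i `<=` U &
    inner_content U <= outer_content (F i) + e / (2 ^ i.+1)%:R].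
  by move=> i; exact: outer_content_adherent.
have oU i : open (U i) by case: (hU i).
apply: le_trans (epsilon_trick _ (fun i => riesz_outer_ge0 (F i)) (ltW e0)).
apply: (@le_trans _ _ (inner_content (\bigcup_i U i))%:E).
  rewrite lee_fin; apply: outer_content_le.
    by apply: bigcup_open => i _; exact: oU.
  by apply: subset_bigcup => i _; case: (hU i).
apply: le_trans (inner_content_sigma_subadditive oU) _.
apply: lee_nneseries => i _ //.
  by move=> _; rewrite lee_fin; have /andP[] := inner_content_bounds (U i).
by rewrite -EFinD lee_fin; case: (hU i).
Qed.

HB.instance Definition _ := isOuterMeasure.Build R X riesz_outer
  riesz_outer0 riesz_outer_ge0 riesz_outer_mono riesz_outer_sigma_subadditive.

(** The set [C] where [e <= f] lies in [U], and [cut e f] vanishes off [C]. For [g] subordinate to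
    [V] minus [C] the two are never nonzero together, so [cut e f + g] is subordinate to [V]. *)
Lemma inner_content_split U V : open U -> open V ->
  inner_content (V `&` U) + outer_content (V `\` U) <= inner_content V.
Proof.
move=> oU oV; rewrite -lerBrDr; apply: inner_content_le => f [cf f01 f0].
apply/ler_addgt0Pr => e e0.
pose C := [set x | e <= f x].
have cC : closed C := closed_superlevel (e := e) cf.
have oVC : open (V `\` C) by apply: openI => //; exact: closed_openC.
suff : outer_content (V `\` U) <= inner_content V - L f + e by lra.
apply: (@le_trans _ _ (inner_content (V `\` C))).
  apply: outer_content_le => // x [Vx Ux]; split=> // /= ex.
  have fx : f x = 0 by apply: f0 => -[].
  by move: ex; rewrite /C /= fx leNgt e0.
apply: inner_content_le => g [cg g01 g0].
have cc := @cut_continuous e _ cf.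
suff : L (cut e f) + L g <= inner_content V by have := state_cut e cf; lra.
rewrite -(stateD sL)//; apply: inner_content_ge; split.
- by move=> x; apply: cvgD; [exact: cc|exact: cg].
- move=> x; have /andP[? ?] := g01 x; have /andP[? ?] := f01 x; rewrite /cut.
  have [ex|ex] := leP e (f x).
    rewrite g0 ?addr0; last by move=> [_]; apply.
    by rewrite le_max lexx/= ge_max ler01/=; lra.
  by rewrite max_l ?add0r ?g01//; lra.
- move=> x Vx; rewrite g0 ?addr0; last by case.
  by rewrite /cut f0 ?max_l//; [lra|case].
Qed.

Lemma open_caratheodory U : open U -> riesz_outer.-caratheodory U.
Proof.
move=> oU; apply: le_caratheodory_measurable => A; rewrite -EFinD lee_fin.
apply: outer_content_ge => V oV AV.
apply: le_trans (inner_content_split oU oV); apply: lerD.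
  apply: outer_content_le; first exact: openI.
  exact: setSI.
by apply: outer_content_mono; exact: setSI.
Qed.

Lemma borel_caratheodory (A : set X) :
  @measurable _ (borel X) A -> riesz_outer.-caratheodory A.
Proof.
have : <<s @open X >> `<=` riesz_outer.-cara.-measurable.
  apply: smallest_sub; last by move=> U oU; exact: open_caratheodory.
  split=> //; first by move=> B mB; rewrite setTD; exact: measurableC.
  by move=> B mB; exact: bigcupT_measurable.
by apply.
Qed.

Definition riesz_measure : set (borel X) -> \bar R := riesz_outer.

Lemma riesz_measure0 : riesz_measure set0 = 0%E. Proof. exact: riesz_outer0. Qed.

Lemma riesz_measure_ge0 A : (0 <= riesz_measure A)%E. Proof. exact: riesz_outer_ge0. Qed.

Lemma riesz_measure_sigma_additive : semi_sigma_additive riesz_measure.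
Proof.
move=> F mF tF mUF; rewrite /riesz_measure.
apply: (@caratheodory_measure_sigma_additive R X riesz_outer) => //.
  by move=> i; exact: borel_caratheodory.
exact: borel_caratheodory.
Qed.

HB.instance Definition _ := isMeasure.Build _ (borel X) R riesz_measure
  riesz_measure0 riesz_measure_ge0 riesz_measure_sigma_additive.

Lemma riesz_measureT : riesz_measure setT = 1%E.
Proof. by rewrite /riesz_measure /riesz_outer outer_content_open ?inner_contentT//; exact: openT. Qed.

HB.instance Definition _ := Measure_isProbability.Build _ (borel X) R riesz_measure
  riesz_measureT.

Definition riesz_probability : probability (borel X) R := riesz_measure.

Lemma riesz_regular : regular_measure riesz_probability.
Proof.
have outer A : riesz_probability A =
    ereal_inf [set riesz_probability U | U in [set U : set X | open U /\ A `<=` U]].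
  apply/eqP; rewrite eq_le; apply/andP; split.
    apply: le_ereal_inf_tmp => _ [U [oU AU] <-].
    by rewrite lee_fin; exact: outer_content_mono.
  apply/lee_addgt0Pr => e e0.
  have [U [oU AU hU]] := outer_content_adherent A e0.
  apply: ge_ereal_inf; exists (riesz_probability U); first by exists U.
  by rewrite -EFinD lee_fin outer_content_open.
move=> A mA; split; first exact: outer.
apply/eqP; rewrite eq_le; apply/andP; split; last first.
  by apply: ge_ereal_sup => _ [C [_ CA] <-]; rewrite lee_fin; exact: outer_content_mono.
apply/lee_addgt0Pr => e e0.
(* Inner regularity of [A] is outer regularity of its complement: the complement of [U] is a compact
   subset of [A]. *)
have [U [oU AU hU]] := outer_content_adherent (~` A) e0.
have cU : closed (~` U) by exact: open_closedC.
have mU : @measurable _ (borel X) U by exact: sub_sigma_algebra.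
apply: (@le_trans _ _ (riesz_probability (~` U) + e%:E)%E); last first.
  apply: leeD2r; apply: ereal_sup_ubound; exists (~` U) => //; split.
    by apply: (subclosed_compact cU X_compact).
  by rewrite -[X in _ `<=` X]setCK; exact: subsetC.
rewrite -[X in riesz_probability X]setCK.
rewrite (probability_setC riesz_probability (measurableC mA)).
rewrite (probability_setC riesz_probability mU).
rewrite -[riesz_probability (~` A)]/((outer_content (~` A))%:E).
rewrite -[riesz_probability U]/((outer_content U)%:E) (outer_content_open oU).
by rewrite -!EFinB -EFinD lee_fin; lra.
Qed.

(** Composition with [act g] carries functions subordinate to [U] to functions subordinate to its
    preimage without changing [L]. This gives one inequality for every [g]; the converse is the same
    inequality for the inverse. *)
Lemma riesz_invariant (G : topologicalGroupType) (act : G -> X -> X) :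
  continuous_action act ->
  (forall (f : X -> R) g, continuous f -> L (fun x => f (act g x)) = L f) ->
  invariant_measure act riesz_probability.
Proof.
move=> ca inv; have [act1 actM _] := ca.
have imE g (A : set X) : act g^-1%g @` A = act g @^-1` A.
  rewrite eqEsubset; split=> x; first by move=> [z Az <-]; rewrite /= -actM mulgV act1.
  by move=> Ax; exists (act g x) => //; rewrite -actM mulVg act1.
have op g U : open U -> open (act g @^-1` U).
  by have /continuousP := @act_continuousr _ _ _ ca g; apply.
have in_le g U : inner_content U <= inner_content (act g @^-1` U).
  apply: inner_content_le => f [cf f01 f0]; rewrite -(inv f g cf).
  apply: inner_content_ge; split => //; last by move=> x Ux; exact: f0.
  exact: (comp_act_continuous ca).
have out_le g A : outer_content (act g @^-1` A) <= outer_content A.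
  apply: outer_content_ge => U oU AU.
  have actK x : act g^-1%g (act g x) = x by rewrite -actM mulVg act1.
  have UE : act g^-1%g @^-1` (act g @^-1` U) = U.
    rewrite eqEsubset; split=> x /=; by rewrite -actM mulgV act1.
  apply: le_trans (_ : inner_content (act g @^-1` U) <= _).
    by apply: outer_content_le; [exact: op|move=> x /AU].
  by rewrite -[in leRHS]UE; exact: in_le.
move=> g A mA; rewrite imE; congr EFin; apply/eqP; rewrite eq_le out_le/=.
have AE : act g^-1%g @^-1` (act g @^-1` A) = A.
  rewrite eqEsubset; split=> x /=; by rewrite -actM mulgV act1.
by rewrite -[in leLHS]AE; exact: out_le.
Qed.

End Riesz.

Unset Implicit Arguments.

Theorem mainTheorem1 (R : realType) (G : topologicalGroupType)
    (hG : polish R G) :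
  amenable R G <->
  (forall act : G -> hilbert_cube R -> hilbert_cube R,
     continuous_action act ->
     exists mu : probability (borel (hilbert_cube R)) R, invariant_measure act mu).
Proof.
split=> [amen act ca|cube_inv X cX hX act ca].
  have [mu [_ inv]] := amen (cube R) (@cube_compact R) (@cube_hausdorff R) act ca.
  by exists mu.
have [[D cD dD] _] := hG.
have [L [sL _] inv] := invariant_state cX ca cD dD cube_inv.
exists (riesz_probability cX hX sL); split; first exact: riesz_regular.
exact: riesz_invariant.
Qed.
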